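(* Let $\mathcal{M}$ be a matroid of rank $r\geq 2$. Then $\nu(I_{\mathcal{M}})=1$ if and only if $\mathcal{M}$ is binary and the diameter of the basis graph $\mathcal{G}_{\mathcal{M}}$ is at most $2$.
   Context: Let $\mathcal{M}$ be a matroid on $E=\{1,\ldots,n\}$ with set of bases $\mathcal{B}$, $k$ a field, $R=k[y_B\mid B\in\mathcal{B}]$ and $\varphi:R\to k[x_1,\ldots,x_n]$ the $k$-algebra map $y_B\mapsto\prod_{i\in B}x_i$; the toric ideal is $I_{\mathcal{M}}=\ker\varphi$. $\nu(I_{\mathcal{M}})$ is the number of minimal generating sets of $I_{\mathcal{M}}$ consisting of binomials, where binomials differing only by sign are identified. A matroid is binary if it is representable over the field with two elements. The basis graph $\mathcal{G}_{\mathcal{M}}$ is the undirected graph with vertex set $\mathcal{B}$ and an edge $\{B,B'\}$ whenever $|B\setminus B'|=1$; its diameter is the maximum distance between two vertices. *)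

(* Defs.v *)
From HB Require Import structures.
From mathcomp Require Import all_boot all_order all_algebra.
From mathcomp Require Import finmap.
From mathcomp Require Import mpoly.

Set Implicit Arguments.
Unset Strict Implicit.
Unset Printing Implicit Defensive.

Import GRing.Theory.
Local Open Scope ring_scope.
Local Open Scope fset_scope.

Definition is_matroid_bases (n : nat) (B : {set {set 'I_n}}) : Prop :=
  B != set0 /\
  forall B1 B2, B1 \in B -> B2 \in B -> forall x, x \in B1 :\: B2 ->
    exists2 y, y \in B2 :\: B1 & (y |: (B1 :\ x)) \in B.

Definition matroid_rank (n : nat) (B : {set {set 'I_n}}) : nat :=
  if [pick X in B] is Some X then #|X| else 0%N.

Definition rows_in_mx (F : fieldType) (n d : nat) (A : 'M[F]_(n, d))
  (X : {set 'I_n}) : 'M[F]_(n, d) :=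
  \matrix_(i < n, j < d) (if i \in X then A i j else 0).

Definition is_basis_of_config (F : fieldType) (n d : nat) (A : 'M[F]_(n, d))
  (X : {set 'I_n}) : bool :=
  (\rank (rows_in_mx A X) == #|X|) && (A <= rows_in_mx A X)%MS.

Definition represents (F : fieldType) (n : nat) (B : {set {set 'I_n}}) : Prop :=
  exists d (A : 'M[F]_(n, d)), forall X : {set 'I_n},
    (X \in B) = is_basis_of_config A X.

Definition binary_matroid (n : nat) (B : {set {set 'I_n}}) : Prop :=
  represents 'F_2 B.

Definition basis_adj (n : nat) (B : {set {set 'I_n}}) : rel {set 'I_n} :=
  fun X Y => [&& X \in B, Y \in B & #|X :\: Y| == 1%N].

Definition basis_dist_le (n : nat) (B : {set {set 'I_n}}) (X Y : {set 'I_n})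
  (d : nat) : Prop :=
  exists p : seq {set 'I_n},
    [/\ path (basis_adj B) X p, last X p = Y & (size p <= d)%N].

Definition basis_graph_diam_le (n : nat) (B : {set {set 'I_n}}) (d : nat) : Prop :=
  forall X Y, X \in B -> Y \in B -> basis_dist_le B X Y d.

(* The toric ideal I_M = ker phi, phi : k[y_B | B in bases] ->        *)
(* k[x_1..x_n], y_B |-> prod_{i in B} x_i.  The variables y_B are     *)
(* indexed by 'I_#|B| via enum_val.                                    *)

Definition toric_images (k : fieldType) (n : nat) (B : {set {set 'I_n}}) :
  #|B|.-tuple {mpoly k[n]} :=
  [tuple \prod_(j in (enum_val i : {set 'I_n})) 'X_j | i < #|B|].

Definition toric_map (k : fieldType) (n : nat) (B : {set {set 'I_n}})
  (p : {mpoly k[#|B|]}) : {mpoly k[n]} :=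
  p \mPo @toric_images k n B.

Definition toric_ideal (k : fieldType) (n : nat) (B : {set {set 'I_n}})
  (p : {mpoly k[#|B|]}) : Prop :=
  @toric_map k n B p = 0.
Arguments toric_map k {n} B p.
Arguments toric_ideal k {n} B p.

Section Gens.
Variables (R : comRingType) (m : nat).
Notation P := {mpoly R[m]}.

Definition in_ideal_gen (G : {fset P}) (p : P) : Prop :=
  exists c : P -> P, p = \sum_(g <- G) c g * g.

Definition generates (I : P -> Prop) (G : {fset P}) : Prop :=
  (forall g, g \in G -> I g) /\ (forall p, I p -> in_ideal_gen G p).

Definition is_binomial (p : P) : Prop :=
  exists u v : 'X_{1..m}, u != v /\ p = 'X_[u] - 'X_[v].

Definition minimal_binomial_gen_set (I : P -> Prop) (G : {fset P}) : Prop :=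
  [/\ forall g, g \in G -> is_binomial g,
      generates I G &
      forall G' : {fset P}, G' `<` G -> ~ generates I G'].

Definition equal_up_to_sign (G G' : {fset P}) : Prop :=
  (forall g, g \in G -> g \in G' \/ - g \in G') /\
  (forall g, g \in G' -> g \in G \/ - g \in G).

Definition nu_eq_1 (I : P -> Prop) : Prop :=
  exists G, minimal_binomial_gen_set I G /\
    forall G', minimal_binomial_gen_set I G' -> equal_up_to_sign G G'.

End Gens.

(* Main.v *)
From Stdlib Require Classical_Prop.
Require Import Defs.
From HB Require Import structures.
From mathcomp Require Import all_boot all_order all_algebra.
From mathcomp Require Import finmap.
From mathcomp Require Import mpoly.
From mathcomp Require Import zify.

(* Two distinct bases give a quadratic monomial y_B y_B', and the monomials with
   the same image as y_B y_B' are pairwise coprime.  Since the ideal contains no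
   linear form, they must be joined by a spanning tree of quadratic generators,
   which is unique exactly when there are at most two of them.  Hence nu = 1
   forces all quadratic fibres to have at most two elements; this forbids U_{2,4}
   minors (so the matroid is binary, by Tutte) and, by symmetric exchange, pairs of
   bases with |B \ B'| >= 3, that is, diameter more than two.
   Conversely, binary and diameter at most two make the quadratic fibres small, and
   it remains to see that the ideal is generated by quadrics.  If all bases
   are pairwise at distance at most two, then either they all contain a fixed set
   of size r - 2, or are all contained in a fixed set of size r + 2, or all differ
   in at most one element from a fixed set of size r.  In each case any
   basis below the exponent of a monomial can be reached by quadratic moves. *)

Set Implicit Arguments.
Unset Strict Implicit.
Unset Printing Implicit Defensive.

(** The exchange axiom does not say what the second basis becomes, whereas comparing monomials
    requires symmetric exchange. Symmetric exchange is obtained here by linear algebra from a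
    representation, so in the forward direction binarity is established before the diameter bound.
    For arbitrary matroids, generation of the toric ideal by quadrics is a conjecture of White. The
    diameter bound leaves only three shapes: rank two matroids padded by a common core, their duals,
    and bases near one set. The same bound yields the dual exchange property, which the second shape
    relies on. Monomials are handled as lists of bases with prescribed coverage, which keeps
    polynomials out of the combinatorics. *)

Ltac uniq_perm4 H :=
  move: H; rewrite /= !inE !negb_or !andbT => /and3P[/and3P[? ? ?] /andP[? ?] ?];
  do !(apply/andP; split) => //; by rewrite eq_sym.

Ltac neqs :=
  rewrite /= ?inE ?negb_or ?andbT; repeat (apply/andP; split);
  first [assumption | done | by rewrite eq_sym].

(** * Basis exchange in families with small diameter *)

Section Exchange.
Variable T : finType.
Implicit Types (B : {set {set T}}) (X Y C S : {set T}).

Definition exchange B := forall X Y, X \in B -> Y \in B ->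
  forall x, x \in X :\: Y -> exists2 y, y \in Y :\: X & (y |: (X :\ x)) \in B.

(** The set form of the diameter bound, by [diam_closeP]: distance in the basis graph is the size of
    the difference. *)
Definition close B := forall X Y, X \in B -> Y \in B -> #|X :\: Y| <= 2.

(** With all six sets present, contracting [C] and restricting to the four elements would give
    $U_{2,4}$. *)
Definition no_U24 B := forall (C : {set T}) a b c d,
  uniq [:: a; b; c; d] -> a \notin C -> b \notin C -> c \notin C -> d \notin C ->
  a |: (b |: C) \in B -> c |: (d |: C) \in B -> a |: (c |: C) \in B ->
  b |: (d |: C) \in B -> a |: (d |: C) \in B -> b |: (c |: C) \in B -> False.

Lemma setU1CA (a b : T) C : a |: (b |: C) = b |: (a |: C).
Proof. by rewrite setUCA. Qed.

Lemma in_setU2 y c d C : y \in c |: (d |: C) -> y \notin C -> y = c \/ y = d.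
Proof. by rewrite !inE => /or3P[/eqP|/eqP|->]; [left|right|]. Qed.

Lemma exchange_card B : exchange B -> {in B &, forall X Y, #|X| = #|Y|}.
Proof.
move=> exB X Y; have [m] := ubnP #|X :\: Y|.
elim: m X Y => // m IHm X Y le_m XB YB.
have [sXY|/subsetPn[x xX xY]] := boolP (X \subset Y).
  have [sYX|/subsetPn[y yY yX]] := boolP (Y \subset X).
    by suff -> : X = Y by []; apply/eqP; rewrite eqEsubset sXY.
  have [|z] := exB _ _ YB XB y; first by rewrite inE yX.
  by rewrite inE => /andP[/negP zY zX]; case: zY; apply: (subsetP sXY).
have [|y] := exB _ _ XB YB x; first by rewrite inE xY.
rewrite inE => /andP[yX yY] X'B.
rewrite -(IHm (y |: (X :\ x)) Y) //.
  by rewrite cardsU1 !inE (negPf yX) andbF (cardsD1 x X) xX.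
apply: leq_trans (_ : #|X :\: Y| <= m); last by rewrite -ltnS.
rewrite (cardsD1 x (X :\: Y)) inE xX xY /=.
rewrite ltnS; apply: subset_leq_card; apply/subsetP=> z; rewrite !inE.
by case: eqP => [->|_]; rewrite /= ?yY //; case/and3P=> -> -> ->.
Qed.

Lemma exchangeU B : exchange B -> forall x S Y, x \notin S -> x |: S \in B ->
  Y \in B -> x \notin Y ->
  exists y, [/\ y \in Y, y != x, y \notin S & y |: S \in B].
Proof.
move=> exB x S Y xS SB YB xY.
have [|y] := exB _ _ SB YB x; first by rewrite !inE xY eqxx.
rewrite !inE negb_or => /andP[/andP[yx yS] yY].
by rewrite setU1K // => H; exists y.
Qed.

Lemma setU1_ind X x : x \in X -> exists2 S : {set T}, x \notin S & X = x |: S.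
Proof. by move=> xX; exists (X :\ x); rewrite ?setD11 ?setD1K. Qed.

Lemma dist2P X Y : #|X :\: Y| = 2 -> #|Y :\: X| = 2 ->
  exists C a b c d,
    [/\ X = a |: (b |: C), Y = c |: (d |: C), uniq [:: a; b; c; d] &
        [/\ a \notin C, b \notin C, c \notin C & d \notin C]].
Proof.
move/eqP/cards2P=> [a [b [nab abE]]]; move/eqP/cards2P=> [c [d [ncd cdE]]].
exists (X :&: Y), a, b, c, d.
have /setP XE := abE; have /setP YE := cdE.
have aX := XE a; have bX := XE b; have cY := YE c; have dY := YE d.
move: aX bX cY dY; rewrite !inE !eqxx ?orbT /=.
move=> /andP[aY aX] /andP[bY bX] /andP[cX cY] /andP[dX dY].
split.
- by apply/setP=> z; have := XE z; rewrite !inE orbA => <-;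
    case: (z \in X); case: (z \in Y).
- by apply/setP=> z; have := YE z; rewrite !inE orbA => <-;
    case: (z \in X); case: (z \in Y).
- rewrite /= !inE !negb_or nab ncd /= !andbT.
  have nXY u v : u \in X -> v \notin X -> u != v by move=> uX; apply: contraNneq => <-.
  by rewrite !nXY.
by rewrite (negPf aY) (negPf bY) (negPf cX) (negPf dX) ?andbF.
Qed.

Lemma card_setD_sym X Y : #|X| = #|Y| -> #|X :\: Y| = #|Y :\: X|.
Proof. by rewrite !cardsD setIC => ->. Qed.

(** Exchange joins each of [a], [b] to one of [c], [d] and conversely. A bipartite graph on 2 + 2
    vertices without isolated vertex has a perfect matching. *)
Lemma matching B : exchange B -> forall C a b c d,
  uniq [:: a; b; c; d] -> a \notin C -> b \notin C -> c \notin C -> d \notin C ->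
  a |: (b |: C) \in B -> c |: (d |: C) \in B ->
  (a |: (c |: C) \in B /\ b |: (d |: C) \in B) \/
  (a |: (d |: C) \in B /\ b |: (c |: C) \in B).
Proof.
move=> exB C a b c d.
rewrite /= !inE !negb_or !andbT => /and3P[/and3P[ab ac ad] /andP[bc bd] cd] aC bC cC dC abB cdB.
have step (x y u v : T) : x != y -> x != u -> x != v -> x \notin C ->
   x |: (y |: C) \in B -> u |: (v |: C) \in B ->
   y |: (u |: C) \in B \/ y |: (v |: C) \in B.
  move=> xy xu xv xC xyB uvB.
  have [| |w [w_in _ w_yC wB]] := exchangeU exB _ xyB uvB.
  - by rewrite !inE negb_or xy.
  - by rewrite !inE !negb_or xu xv.
  move: w_yC wB; rewrite inE negb_or => /andP[_ wC].
  by case: (in_setU2 w_in wC) => ->; rewrite setU1CA; [left|right].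
have baB : b |: (a |: C) \in B by rewrite setU1CA.
have dcB : d |: (c |: C) \in B by rewrite setU1CA.
have nba : b != a by rewrite eq_sym.
have ndc : d != c by rewrite eq_sym.
have [Ha|Ha] := step b a c d nba bc bd bC baB cdB.
  have [Hb|Hb] := step a b c d ab ac ad aC abB cdB; last by left.
  have := step c d a b cd; rewrite ![c == _]eq_sym => /(_ ac bc cC cdB abB).
  by rewrite ![d |: (_ |: _)]setU1CA => -[Hd|Hd]; [right|left].
have [Hb|Hb] := step a b c d ab ac ad aC abB cdB; first by right.
have := step d c a b ndc; rewrite ![d == _]eq_sym => /(_ ad bd dC dcB abB).
by rewrite ![c |: (_ |: _)]setU1CA => -[Hd|Hd]; [left|right].
Qed.

(** Here the entering element is prescribed instead of the leaving one. Closeness leaves two cases: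
    at distance two [matching] provides the exchange, and at distance one only one exchange is
    possible. *)
Lemma dual_exchange B : exchange B -> close B -> forall X Y q,
  X \in B -> Y \in B -> q \in Y -> q \notin X ->
  exists y, [/\ y \in X, y \notin Y & q |: (X :\ y) \in B].
Proof.
move=> exB clB X Y q XB YB qY qX.
have eqc := card_setD_sym (exchange_card exB XB YB).
have := clB _ _ XB YB; rewrite leq_eqVlt => /predU1P[X2|].
  have Y2 : #|Y :\: X| = 2 by rewrite -eqc.
  have [C [a [b [c [d [XE YE abcd [aC bC cC dC]]]]]]] := dist2P X2 Y2.
  have M : (a |: (c |: C) \in B /\ b |: (d |: C) \in B) \/
     (a |: (d |: C) \in B /\ b |: (c |: C) \in B).
    by apply: matching => //; rewrite -?XE -?YE.
  move: abcd; rewrite /= !inE !negb_or !andbT.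
  move=> /and3P[/and3P[ab ac ad] /andP[bc bd] cd].
  have qC : q \notin C by apply: contra qX; rewrite XE !inE => ->; rewrite !orbT.
  have aY : a \notin Y by rewrite YE !inE !negb_or ac ad.
  have bY : b \notin Y by rewrite YE !inE !negb_or bc bd.
  have XDa : X :\ a = b |: C by rewrite XE setU1K // !inE negb_or ab.
  have XDb : X :\ b = a |: C.
    by rewrite XE setU1CA setU1K // !inE negb_or eq_sym ab.
  have aX : a \in X by rewrite XE !inE eqxx.
  have bX : b \in X by rewrite XE !inE eqxx orbT.
  rewrite YE in qY; case: (in_setU2 qY qC) => ->.
    case: M => -[H1 H2]; [exists b|exists a]; split; rewrite ?XDa ?XDb //;
    by rewrite setU1CA.
  case: M => -[H1 H2]; [exists a|exists b]; split; rewrite ?XDa ?XDb //;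
  by rewrite setU1CA.
rewrite ltnS => leX1.
have qYX : q \in Y :\: X by rewrite inE qX.
have /card_gt0P[x] : 0 < #|X :\: Y| by rewrite eqc; apply/card_gt0P; exists q.
rewrite inE => /andP[xY xX]; exists x; split => //.
have [|y] := exB X Y XB YB x; first by rewrite inE xY.
move=> yYX; suff -> : y = q by [].
rewrite eqc in leX1; apply/eqP; apply: contraTT leX1 => yq; rewrite -ltnNge.
apply: leq_trans (_ : #|[set y; q]| <= _); first by rewrite cards2 yq.
by apply: subset_leq_card; rewrite subUset !sub1set yYX.
Qed.

Lemma close_far B X Y x y z : close B -> X \in B -> Y \in B ->
  uniq [:: x; y; z] -> x \in X -> y \in X -> z \in X ->
  x \notin Y -> y \notin Y -> z \notin Y -> False.
Proof.
move=> clB XB YB; rewrite /= !inE !negb_or !andbT => /andP[/andP[xy xz] yz].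
move=> xX yX zX xY yY zY; have := clB _ _ XB YB; apply/negP; rewrite -ltnNge.
apply: leq_trans (_ : #|[set x; y; z]| <= _).
  by rewrite setUC cardsU1 cards2 !inE negb_or xy (eq_sym z) xz (eq_sym z) yz.
by apply: subset_leq_card; rewrite !subUset !sub1set !inE xX xY yX yY zX zY.
Qed.

(** For a common basis [X] of two matroids: the fundamental circuits with respect to [X]
    coincide. *)
Definition agree_near (M M' : {set {set T}}) X := forall e f, e \in X -> f \notin X ->
  (f |: (X :\ e) \in M) = (f |: (X :\ e) \in M').

(** Write [X = C + ab] and [Y = C + cd]. The four mixed pairs are neighbours of [X], so [M] and [M']
    agree on them. One matching is in [M], and the other is not entirely in [M], since that would
    complete a $U_{2,4}$. *)
Lemma agree_dist2 M M' X Y : exchange M -> exchange M' -> no_U24 M ->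
  X \in M -> X \in M' -> agree_near M M' X -> Y \in M ->
  #|X :\: Y| = 2 -> Y \in M'.
Proof.
move=> exM exM' noM XM XM' nearX YM X2.
have Y2 : #|Y :\: X| = 2 by rewrite -(card_setD_sym (exchange_card exM XM YM)).
have [C [a [b [c [d [XE YE abcd [aC bC cC dC]]]]]]] := dist2P X2 Y2.
(* With [yu] missing, exchanging [x] out of [C + xu] against [C + yv] inside [M'] can only bring in
   [v], and the result is [Y]. *)
have cross (x y u v : T) : uniq [:: x; y; u; v] -> u |: (v |: C) = Y ->
    y |: (x |: C) = X -> x \notin C -> y \notin C -> u \notin C -> v \notin C ->
    x |: (u |: C) \in M -> y |: (v |: C) \in M -> y |: (u |: C) \notin M -> Y \in M'.
  rewrite /= !inE !negb_or !andbT => /and3P[/and3P[xy xu xv] /andP[yu yv] uv].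
  move=> uvE xyE xC yC uC vC xuM yvM yuM.
  have XDx : X :\ x = y |: C.
    by rewrite -xyE setU1CA setU1K // !inE negb_or xy.
  have XDy : X :\ y = x |: C.
    by rewrite -xyE setU1K // !inE negb_or eq_sym xy.
  have uX : u \notin X by rewrite -xyE !inE !negb_or (eq_sym u y) yu eq_sym xu.
  have vX : v \notin X by rewrite -xyE !inE !negb_or (eq_sym v y) yv eq_sym xv.
  have xX : x \in X by rewrite -xyE !inE eqxx orbT.
  have yX : y \in X by rewrite -xyE !inE eqxx.
  have xuM' : x |: (u |: C) \in M'.
    by rewrite setU1CA -XDy -nearX // XDy setU1CA.
  have yuM' : y |: (u |: C) \notin M'.
    by rewrite setU1CA -XDx -nearX // XDx setU1CA.
  have yvM' : y |: (v |: C) \in M'.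
    by rewrite setU1CA -XDx -nearX // XDx setU1CA.
  have [||w [wyv wx wuC wM']] := exchangeU exM' _ xuM' yvM'.
  - by rewrite !inE negb_or xu.
  - by rewrite !inE !negb_or xy xv.
  move: wuC; rewrite inE negb_or => /andP[wu wC].
  case: (in_setU2 wyv wC) => wE; rewrite wE in wM'; first by rewrite wM' in yuM'.
  by rewrite -uvE setU1CA.
have U1 : uniq [:: b; a; d; c] by uniq_perm4 abcd.
have U2 : uniq [:: b; a; c; d] by uniq_perm4 abcd.
have U3 : uniq [:: a; b; d; c] by uniq_perm4 abcd.
rewrite XE in XM; rewrite YE in YM.
have dcY : d |: (c |: C) = Y by rewrite YE setU1CA.
have baX : b |: (a |: C) = X by rewrite XE setU1CA.
have [[acM bdM]|[adM bcM]] := matching exM abcd aC bC cC dC XM YM.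
  have [bcM|bcM] := boolP (b |: (c |: C) \in M); last first.
    exact: (cross a b c d).
  have [adM|adM] := boolP (a |: (d |: C) \in M); last first.
    exact: (cross b a d c).
  by case: (noM C a b c d).
have [acM|acM] := boolP (a |: (c |: C) \in M); last first.
  exact: (cross b a c d).
have [bdM|bdM] := boolP (b |: (d |: C) \in M); last first.
  exact: (cross a b d c).
by case: (noM C a b c d).
Qed.

Lemma card_exchange X Y e f : e \in X -> e \notin Y -> f \in Y ->
  #|X :\: Y| = (#|(f |: (X :\ e)) :\: Y|).+1.
Proof.
move=> eX eY fY; rewrite (cardsD1 e) inE eX eY /=; congr _.+1; apply: eq_card => z.
rewrite !inE; have [->|_] := eqVneq z f; first by rewrite fY andbF.
by case: (z == e); case: (z \in X); case: (z \in Y).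
Qed.

(* Agreement at distance one spreads to distance two, hence to the
   neighbourhood of an adjacent basis, hence along a path of exchanges. *)
Lemma agree_sub M M' X Y : exchange M -> exchange M' -> no_U24 M -> no_U24 M' ->
  X \in M -> X \in M' -> agree_near M M' X -> Y \in M -> Y \in M'.
Proof.
move=> exM exM' noM noM'; have [m] := ubnP #|X :\: Y|.
elim: m X Y => // m IHm X Y leXY XM XM' nearX YM.
have [sXY|/subsetPn[e eX eY]] := boolP (X \subset Y).
  suff <- : X = Y by [].
  by apply/eqP; rewrite eqEcard sXY (exchange_card exM XM YM) leqnn.
have [|f] := exM X Y XM YM e; first by rewrite inE eY.
rewrite inE => /andP[fX fY] ZM; set Z := _ |: _ in ZM.
have ZM' : Z \in M' by rewrite -nearX.
apply: (IHm Z) => //.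
  by rewrite -ltnS; apply: leq_trans leXY; rewrite ltnS (card_exchange eX eY fY).
(* Agreement must be carried from [X] to [Z]. A neighbour [W] of [Z] is within two exchanges of [X]:
   one exchange is the hypothesis, two are [agree_dist2], applied in both directions. *)
move=> e1 f1 e1Z f1Z.
have nearX' : agree_near M' M X by move=> ? ? ? ?; rewrite nearX.
have cW : #|f1 |: (Z :\ e1)| = #|X|.
  have -> : #|X| = #|Z| by rewrite (exchange_card exM XM ZM).
  by rewrite cardsU1 in_setD1 (negPf f1Z) andbF (cardsD1 e1 Z) e1Z.
set W := f1 |: (Z :\ e1) in cW *.
have le2 : #|X :\: W| <= 2.
  apply: leq_trans (_ : #|[set e; e1]| <= _); last by rewrite cards2; case: eqP.
  apply: subset_leq_card; apply/subsetP=> z; rewrite !inE.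
  by case: (z == e); case: (z == e1); rewrite ?andbT ?andbF //=; case: (z \in X); rewrite ?orbT ?andbF.
clearbody W; case: (ltngtP #|X :\: W| 2) le2 => // [lt2 _|eq2 _]; last first.
  apply/idP/idP => WM; first exact: (agree_dist2 exM exM' noM XM XM' nearX WM).
  exact: (agree_dist2 exM' exM noM' XM' XM nearX' WM).
have [sXW|/subsetPn[x xX xW]] := boolP (X \subset W).
  suff <- : X = W by rewrite XM XM'.
  by apply/eqP; rewrite eqEcard sXW cW leqnn.
have /card_gt0P[y yWX] : 0 < #|W :\: X|.
  by rewrite -(card_setD_sym (esym cW)); apply/card_gt0P; exists x; rewrite inE xW.
have /andP[yX yW] : (y \notin X) && (y \in W) by rewrite inE in yWX.
suff -> : W = y |: (X :\ x) by apply: nearX.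
apply/esym/eqP; rewrite eqEcard cardsU1 !inE (negPf yX) andbF.
rewrite cW (cardsD1 x X) xX leqnn andbT.
rewrite subUset sub1set yW; apply/subsetP=> z; rewrite !inE => /andP[zx zX].
apply: contraTT lt2 => zW; rewrite -leqNgt.
apply: leq_trans (_ : #|[set z; x]| <= _); first by rewrite cards2 zx.
by apply: subset_leq_card; rewrite subUset !sub1set !inE zX zW xX xW.
Qed.

(* The bases C+ab, C+bd, C+dc, C+ca are the edges of a 4-cycle a-b-d-c, whose
   symmetries reduce most of the cases below to one another. *)
Definition square B C a b c d : Prop :=
  [/\ uniq [:: a; b; c; d],
      [/\ a \notin C, b \notin C, c \notin C & d \notin C] &
      [/\ a |: (b |: C) \in B, c |: (d |: C) \in B,
          a |: (c |: C) \in B & b |: (d |: C) \in B]].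

Lemma square_opp B C a b c d : square B C a b c d -> square B C c d a b.
Proof.
move=> [U [? ? ? ?] [? ? ? ?]]; split => //; first by uniq_perm4 U.
by split; rewrite // setU1CA.
Qed.

Lemma square_tr B C a b c d : square B C a b c d -> square B C a c b d.
Proof. by move=> [U [? ? ? ?] [? ? ? ?]]; split => //; uniq_perm4 U. Qed.

Lemma square_rev B C a b c d : square B C a b c d -> square B C b a d c.
Proof.
move=> [U [? ? ? ?] [? ? ? ?]]; split => //; first by uniq_perm4 U.
by split; rewrite // setU1CA.
Qed.

(** * Bases around a square of exchanges *)

Section Close.
Variable B : {set {set T}}.
Hypotheses (exB : exchange B) (clB : close B).

(** Exchange [p] out of [p + C + ab] against [W]. An incoming element other than [c], [d] would
    leave [c], [d], [p] as three differences from the opposite basis. *)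
Lemma square_missing p C a b c d W :
  p \notin C -> square B (p |: C) a b c d -> W \in B -> p \notin W ->
  (c \in W /\ c |: (a |: (b |: C)) \in B) \/
  (d \in W /\ d |: (a |: (b |: C)) \in B).
Proof.
move=> pC [U [aC bC cC dC] [abB cdB _ _]] WB pW.
move: U; rewrite /= !inE !negb_or !andbT.
move=> /and3P[/and3P[ab ac ad] /andP[bc bd] cd].
move: aC bC cC dC; rewrite !inE !negb_or.
move=> /andP[ap aC] /andP[bp bC] /andP[cp cC] /andP[dp dC].
have abB' : p |: (a |: (b |: C)) \in B.
  by move: abB; rewrite (setU1CA b) (setU1CA a).
have [|y [yW yp yS yB]] := exchangeU exB _ abB' WB pW; first by neqs.
move: yS; rewrite !inE !negb_or => /and3P[ya yb yC].
have [yc|yc] := eqVneq y c; first by left; rewrite -yc.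
have [yd|yd] := eqVneq y d; first by right; rewrite -yd.
case: (@close_far _ _ _ c d p clB cdB yB); rewrite ?inE ?eqxx ?orbT //; neqs.
Qed.

(** Bring [q] into [C + ab] by dual exchange. If an element of [C] left, it would differ from
    [C + cd] together with [c] and [d]. *)
Lemma square_extra q C a b c d W :
  square B C a b c d -> q \notin [:: a; b; c; d] -> q \notin C -> W \in B ->
  q \in W ->
  (a \notin W /\ q |: (b |: C) \in B) \/ (b \notin W /\ q |: (a |: C) \in B).
Proof.
move=> [U [aC bC cC dC] [abB cdB _ _]].
rewrite !inE !negb_or => /and4P[qa qb qc qd] qC WB qW.
move: U; rewrite /= !inE !negb_or !andbT.
move=> /and3P[/and3P[ab ac ad] /andP[bc bd] cd].
have [|y [yab yW yB]] := dual_exchange exB clB abB WB qW.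
  by rewrite !inE !negb_or qa qb.
have [ya|ya] := eqVneq y a.
  by left; move: yW yB; rewrite ya => ?; rewrite setU1K //; neqs.
have [yb|yb] := eqVneq y b.
  by right; move: yW yB; rewrite yb (setU1CA a) => ?; rewrite setU1K //; neqs.
have yC : y \in C by move: yab; rewrite !inE (negPf ya) (negPf yb).
have yc : y != c by apply: contraNneq cC => <-.
have yd : y != d by apply: contraNneq dC => <-.
case: (@close_far _ _ _ c d y clB cdB yB); rewrite /= ?inE ?eqxx ?orbT //.
- by neqs.
- by rewrite yC !orbT.
- by rewrite negb_or negb_and orbC; apply/andP; split; [neqs|apply/orP; left; neqs].
- by rewrite negb_or negb_and orbC; apply/andP; split; [neqs|apply/orP; left; neqs].
by rewrite orbF; apply: contraNneq qC => <-.
Qed.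

(** The set with [q] and [c] is at distance three from [abd + C]. For the set with [q] and [b],
    exchanging [p] out against [abd + C] brings in [a] or [d], and either result is at distance
    three from a side of the square. *)
Lemma square_missing_extra p q C a b c d :
  p \notin C -> square B (p |: C) a b c d -> q \notin [:: a; b; c; d] ->
  q \notin p |: C -> d |: (a |: (b |: C)) \in B ->
  q |: (b |: (p |: C)) \notin B /\ q |: (c |: (p |: C)) \notin B.
Proof.
move=> pC [U [aC bC cC dC] [abB cdB acB bdB]].
rewrite !inE !negb_or => /and4P[qa qb qc qd] /andP[qp qC] dabB.
move: U; rewrite /= !inE !negb_or !andbT.
move=> /and3P[/and3P[ab ac ad] /andP[bc bd] cd].
move: aC bC cC dC; rewrite !inE !negb_or.
move=> /andP[ap aC] /andP[bp bC] /andP[cp cC] /andP[dp dC].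
split; apply/negP => qB; last first.
  apply: (@close_far _ _ _ a b d clB dabB qB); rewrite ?inE ?eqxx ?orbT //; neqs.
have qB' : p |: (q |: (b |: C)) \in B.
  by move: qB; rewrite (setU1CA b) (setU1CA q).
have [||y [y_in yp yS yB]] := exchangeU exB _ qB' dabB.
- by neqs.
- by neqs.
move: y_in yS; rewrite !inE !negb_or => y_in /and3P[yq yb yC].
move: y_in; rewrite (negPf yb) (negPf yC) !orbF => /orP[]/eqP yE; rewrite yE in yB.
  apply: (@close_far _ _ _ a c p clB acB yB); rewrite ?inE ?eqxx ?orbT //; neqs.
apply: (@close_far _ _ _ c d p clB cdB yB); rewrite ?inE ?eqxx ?orbT //; neqs.
Qed.

(** One basis omitting part of the core and one leaving the square are so restrictive together that
    every basis is pinned near the diagonal [C + ad]. *)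
Lemma square_center C a b c d p0 W0 q0 W :
  square B C a b c d -> p0 \in C -> W0 \in B -> p0 \notin W0 ->
  q0 \notin [:: a; b; c; d] -> q0 \notin C -> q0 |: (a |: C) \in B ->
  W \in B -> #|W :\: (a |: (d |: C))| <= 1.
Proof.
move=> sq p0C W0B p0W0 q0abcd q0C q0B.
have sqO := square_opp sq; have sqT := square_tr sq; have sqR := square_rev sq.
(* By [square_missing_extra] on rotated squares, the basis [C + q0 a] rules out [abc + C - p] and
   [bcd + C - p]. In the two uses of [square_missing] only the alternatives with [d] and with [a]
   survive. *)
have missing p V : p \in C -> V \in B -> p \notin V ->
    [/\ a \in V, d \in V, d |: (a |: (b |: (C :\ p))) \in B &
        d |: (a |: (c |: (C :\ p))) \in B].
  move=> pC VB pV; have CE : C = p |: (C :\ p) by rewrite setD1K.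
  have pC' : p \notin C :\ p by rewrite setD11.
  move: (C :\ p) CE pC' => D CE pD; rewrite CE in sq sqO sqR q0C q0B.
  have nd : c |: (a |: (b |: D)) \notin B.
    apply/negP => FB.
    have [||nq _] := square_missing_extra pD sqR (q := q0) _ q0C.
    - by move: q0abcd; rewrite !inE !negb_or => /and4P[-> -> -> ->].
    - by rewrite (setU1CA b).
    by rewrite q0B in nq.
  have na : c |: (d |: (b |: D)) \notin B.
    apply/negP => FB.
    have [||_ nq] := square_missing_extra pD (square_tr sqR) (q := q0) _ q0C.
    - by move: q0abcd; rewrite !inE !negb_or => /and4P[-> -> -> ->].
    - by rewrite (setU1CA b).
    by rewrite q0B in nq.
  have [[_ FB]|[dV FdB]] := square_missing pD sq VB pV; first by rewrite FB in nd.
  have [[aV FaB]|[_ FB]] := square_missing pD sqO VB pV; last first.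
    by move: na; rewrite (setU1CA d) (setU1CA c) -(setU1CA b) FB ?(setU1CA b c) ?FB.
  split => //; move: FaB.
  by rewrite (setU1CA c) (setU1CA a d).
(* Because of [W0], [abd + C - p0] is a basis, which excludes [C + qb] and [C + qc]. So
   [square_extra] must drop [b], and on the transposed square [c]. *)
have extra q V : q \notin [:: a; b; c; d] -> q \notin C -> V \in B -> q \in V ->
    b \notin V /\ c \notin V.
  move=> qabcd qC VB qV; have [_ _ FB _] := missing _ _ p0C W0B p0W0.
  have CE : C = p0 |: (C :\ p0) by rewrite setD1K.
  have p0C' : p0 \notin C :\ p0 by rewrite setD11.
  have [nb nc] : q |: (b |: C) \notin B /\ q |: (c |: C) \notin B.
    by rewrite CE; apply: square_missing_extra FB => //; rewrite -CE.
  have [[_ qB]|[bV _]] := square_extra sq qabcd qC VB qV; first by rewrite qB in nb.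
  have [|[_ qB]|[cV _]] := square_extra sqT _ qC VB qV; last by [].
    by move: qabcd; rewrite !inE !negb_or => /and4P[-> -> -> ->].
  by rewrite qB in nc.
case: (sq) => U [aC bC cC dC] [abB cdB acB bdB].
move: U; rewrite /= !inE !negb_or !andbT.
move=> /and3P[/and3P[ab ac ad] /andP[bc bd] cd].
move=> WB; rewrite leqNgt; apply/negP => /card_gt1P[s [t [sW tW st]]].
have outside x : x \in W :\: (a |: (d |: C)) -> x != b -> x != c ->
    [/\ x \in W, x \notin [:: a; b; c; d] & x \notin C].
  rewrite !inE !negb_or => /andP[/and3P[xa xd xC] xW] xb xc.
  by rewrite xW xa xb xc xd xC.
have [/andP[sbc tbc]|] := boolP ((s \in [:: b; c]) && (t \in [:: b; c])).
  have [bW cW] : b \in W /\ c \in W.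
    move: sW tW; rewrite !inE => /andP[_ sW] /andP[_ tW]; move: sbc tbc st sW tW.
    by rewrite !inE => /orP[]/eqP-> /orP[]/eqP-> //; rewrite eqxx.
  have WC x : x \in W -> [|| x \in C, x == a, x == b, x == c | x == d].
    move=> xW; apply: contraTT bW; rewrite !negb_or => /and5P[xC xa xb xc xd].
    by case: (extra x W _ xC WB xW) => //; rewrite !inE !negb_or xa xb xc xd.
  have cardE V : V \in B -> #|V| = #|C|.+2.
    move=> VB; rewrite (exchange_card exB VB abB) !cardsU1 bC.
    by rewrite !inE negb_or ab aC.
  (* If [C] lies in [W], then [W = C + bc]. Exchanging [p0] out lets in only one of [a] and [d], but
     [missing] asks for both. *)
  have [CW|/subsetPn[p pC pW]] := boolP (C \subset W).
    have WE : W = b |: (c |: C).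
      apply/esym/eqP; rewrite eqEcard cardE // !cardsU1 cC !inE negb_or bc bC.
      by rewrite leqnn andbT !subUset !sub1set bW cW.
    have [_ _ FB _] := missing _ _ p0C W0B p0W0.
    rewrite WE -(setD1K p0C) (setU1CA c) (setU1CA b) in WB.
    have p0D : p0 \notin C :\ p0 by rewrite setD11.
    have [p0b p0c p0a p0d] : [/\ p0 != b, p0 != c, p0 != a & p0 != d].
      by split; [move: bC|move: cC|move: aC|move: dC]; apply: contraNneq => <-.
    have aD : a \notin C :\ p0 by rewrite in_setD1 (negPf aC) andbF.
    have dD : d \notin C :\ p0 by rewrite in_setD1 (negPf dC) andbF.
    move: (C :\ p0) p0D aD dD WB FB => D p0D aD dD WB FB.
    have [||y [y_in yp yS yB]] := exchangeU exB _ WB FB; [by neqs|by neqs|].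
    have [|aV dV _ _] := missing p0 _ p0C yB; first by neqs.
    move: aV dV; rewrite !in_setU1 (negPf aD) (negPf dD) !orbF.
    rewrite (negPf ab) (negPf ac) ![d == _]eq_sym (negPf bd) (negPf cd) !orbF.
    by move=> /eqP ya /eqP yd; case/eqP: ad; rewrite ya yd.
  have [aW dW _ _] := missing _ _ pC WB pW.
  (* Exchanging [d] out brings in an element of [C]. The new basis omits [d], so by [missing] it
     contains all of [C], and also [a], [b], [c]: one element too many. *)
  have [S dS WE] := setU1_ind dW; rewrite WE in WB.
  have [|y [y_in yd yS yB]] := exchangeU exB dS WB abB; first by neqs.
  have inS x : x \in W -> x != d -> x \in S.
    by rewrite WE !inE => /orP[->|].
  have yC : y \in C.
    move: y_in; rewrite !inE => /or3P[/eqP ya|/eqP yb|//].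
      by case/negP: yS; rewrite ya; apply: inS.
    by case/negP: yS; rewrite yb; apply: inS.
  have dy : d \notin y |: S by rewrite !inE negb_or eq_sym yd.
  have [CyS|/subsetPn[p' p'C p'y]] := boolP (C \subset y |: S); last first.
    by have [_ ] := missing _ _ p'C yB p'y; rewrite (negPf dy).
  have : #|a |: (b |: (c |: C))| <= #|y |: S|.
    apply: subset_leq_card; rewrite !subUset !sub1set !in_setU1 CyS.
    by rewrite !inS ?orbT.
  rewrite (cardE _ yB) !cardsU1 cC !inE !negb_or bc bC ab ac aC /=.
  by rewrite !add1n ltnn.
move=> nst; have [x [xW' xb xc]] : exists x,
    [/\ x \in W :\: (a |: (d |: C)), x != b & x != c].
  move: nst; rewrite !inE negb_and !negb_or => /orP[]/andP[? ?].
    by exists s.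
  by exists t.
have [xW xabcd xC] := outside x xW' xb xc.
have [bW cW] := extra x W xabcd xC WB xW.
have nbc z : z \in W :\: (a |: (d |: C)) ->
    [/\ z \in W, z \notin [:: a; b; c; d] & z \notin C].
  move=> zW; apply: (outside _ zW); move: zW; rewrite inE => /andP[_ zW];
  by [apply: contraNneq bW => <-|apply: contraNneq cW => <-].
have [{}sW sabcd sC] := nbc s sW; have [{}tW tabcd tC] := nbc t tW.
move: sabcd tabcd; rewrite !inE !negb_or => /and4P[sa sb sc sd] /and4P[ta tb tc td].
(* With [s] and [t], either [d] or [a] would make a third difference from [C + ab] or [C + cd]. So
   [W] avoids the whole square, and exchanging [a] out of [C + ab] adds an outside element while
   keeping [b], against [extra]. *)
have dW : d \notin W.
  apply/negP => dW.
  by apply: (@close_far _ _ _ s t d clB WB abB) => //; neqs.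
have aW : a \notin W.
  apply/negP => aW.
  by apply: (@close_far _ _ _ s t a clB WB cdB) => //; neqs.
have [|y [yW ya yS yB]] := exchangeU exB _ abB WB aW; first by neqs.
move: yS; rewrite !inE !negb_or => /andP[yb yC].
have [||/negP[]] := extra y _ _ yC yB; rewrite !inE ?eqxx ?orbT //.
rewrite (negPf ya) (negPf yb) /=; apply/norP.
by split; apply: contraTneq yW => ->.
Qed.

End Close.

Lemma trichotomy B : exchange B -> close B -> B != set0 ->
  [\/ exists C0 : {set T}, forall X, X \in B -> C0 \subset X /\ #|X| = #|C0|.+2,
      exists U : {set T}, forall X, X \in B -> X \subset U /\ #|U| = #|X|.+2 |
      exists Z : {set T}, forall X, X \in B -> #|X| = #|Z| /\ #|X :\: Z| <= 1].
Proof.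
move=> exB clB /set0Pn[X XB].
have cardB := exchange_card exB.
have [/forall_inP near|] := boolP [forall Y in B, #|Y :\: X| <= 1].
  by constructor 3; exists X => Y YB; split; [apply: cardB|apply: near].
rewrite negb_forall_in => /exists_inP[Y YB]; rewrite -ltnNge => gtY.
have Y2 : #|Y :\: X| = 2 by apply/eqP; rewrite eqn_leq gtY clB.
have X2 : #|X :\: Y| = 2 by rewrite (card_setD_sym (cardB _ _ XB YB)).
have [C [a [b [c [d [XE YE U [aC bC cC dC]]]]]]] := dist2P X2 Y2.
rewrite {}XE {}YE {X2 Y2 gtY X Y} in XB YB.
wlog sq : c d U cC dC YB / square B C a b c d.
  move=> wsq; have [[]|[adB bcB]] := matching exB U aC bC cC dC XB YB.
    by move=> acB bdB; apply: (wsq c d).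
  have U' : uniq [:: a; b; d; c] by uniq_perm4 U.
  have YB' : d |: (c |: C) \in B by rewrite setU1CA.
  by apply: (wsq d c) => //; split.
have cardX X : X \in B -> #|X| = #|C|.+2.
  move=> /cardB -/(_ _ XB) ->; move: U; rewrite /= !inE !negb_or !andbT.
  by move=> /and3P[/and3P[ab _ _] _ _]; rewrite !cardsU1 bC !inE negb_or ab aC.
have [/forall_inP sub|] := boolP [forall W in B, C \subset W].
  by constructor 1; exists C => W WB; rewrite cardX // sub.
rewrite negb_forall_in => /exists_inP[W0 W0B /subsetPn[p0 p0C p0W0]].
set V := [set x in [:: a; b; c; d]] :|: C.
have [/forall_inP sub|] := boolP [forall W in B, W \subset V].
  constructor 2; exists V => W WB; rewrite sub // (cardX W) //; split => //.
  rewrite cardsU disjoint_setI0 ?cards0 ?subn0 ?cardsE ?(card_uniqP U) //.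
  rewrite disjoints_subset; apply/subsetP=> z; rewrite !inE.
  by case/or4P => /eqP->.
rewrite negb_forall_in => /exists_inP[W1 W1B /subsetPn[q qW1]].
rewrite in_setU inE negb_or => /andP[qabcd qC].
have [[_ qB]|[_ qB]] := square_extra exB clB sq qabcd qC W1B qW1.
  have sqR := square_rev sq; constructor 3; exists (b |: (c |: C)) => W WB.
  split; last first.
    apply: (square_center exB clB sqR p0C W0B p0W0 _ qC) => //.
    by move: qabcd; rewrite !inE !negb_or => /and4P[-> -> -> ->].
  rewrite cardX //; move: U; rewrite /= !inE !negb_or.
  by move=> /and4P[_ /andP[bc _] _ _]; rewrite !cardsU1 cC !inE negb_or bc bC.
constructor 3; exists (a |: (d |: C)) => W WB; split; last first.
  exact: (square_center exB clB sq p0C W0B p0W0 qabcd qC).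
rewrite cardX //; move: U; rewrite /= !inE !negb_or.
by move=> /andP[/and3P[_ _ ad] _]; rewrite !cardsU1 dC !inE negb_or ad aC.
Qed.

End Exchange.

(** * Connectivity of fibres *)

Section Reach.
Variable T : finType.
Implicit Types (B : {set {set T}}) (l : seq {set T}) (X Y C S : {set T}).

Definition cover_count l i := count (fun X : {set T} => i \in X) l.

(** Lists stand for monomials, hence the permutations. A swap replaces a quadratic factor by another
    one of the same fibre. *)
Inductive connected_by B : seq {set T} -> seq {set T} -> Prop :=
| conn_perm l l' : perm_eq l l' -> connected_by B l l'
| conn_swap X Y X' Y' l : X' \in B -> Y' \in B ->
    cover_count [:: X; Y] =1 cover_count [:: X'; Y'] ->
    connected_by B (X :: Y :: l) (X' :: Y' :: l)
| conn_trans l1 l2 l3 : connected_by B l1 l2 -> connected_by B l2 l3 ->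
    connected_by B l1 l3.

Lemma conn_refl B l : connected_by B l l.
Proof. exact: conn_perm. Qed.

Lemma conn_cons B Z l l' : connected_by B l l' -> connected_by B (Z :: l) (Z :: l').
Proof.
elim=> [{}l {}l' pl|X Y X' Y' {}l X'B Y'B cov|l1 l2 l3 _ H12 _ H23].
- by apply: conn_perm; rewrite perm_cons.
- have toFront (U V : {set T}) : perm_eq (Z :: U :: V :: l) (U :: V :: Z :: l).
    by apply/permP=> p /=; rewrite addnCA (addnCA (p Z)).
  apply: conn_trans (conn_perm B (toFront X Y)) _.
  apply: conn_trans (conn_swap _ X'B Y'B cov) _.
  by apply: conn_perm; rewrite perm_sym.
exact: conn_trans H12 H23.
Qed.

Lemma cover_count_cons X l i : cover_count (X :: l) i = (i \in X) + cover_count l i.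
Proof. by []. Qed.

Lemma conn_cover B l l' : connected_by B l l' -> cover_count l =1 cover_count l'.
Proof.
elim=> [{}l {}l' pl|X Y X' Y' {}l _ _ cov|l1 l2 l3 _ H12 _ H23] i.
- exact: (permP pl).
- by have := cov i; rewrite !cover_count_cons addn0 !addnA => ->; rewrite addn0.
by rewrite H12.
Qed.

Lemma conn_all B l l' : connected_by B l l' -> {subset l <= B} -> {subset l' <= B}.
Proof.
elim=> [{}l {}l' pl sl X|X Y X' Y' {}l X'B Y'B _ sl Z|l1 l2 l3 _ H12 _ H23].
- by rewrite -(perm_mem pl); apply: sl.
- rewrite !inE => /or3P[/eqP->|/eqP->|Zl] //.
  by apply: sl; rewrite !inE Zl !orbT.
by move/H12.
Qed.

Lemma perm_rem2 X Y l : X \in l -> Y \in l -> X != Y ->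
  perm_eq l (X :: Y :: rem Y (rem X l)).
Proof.
move=> Xl Yl XY; have pX := perm_to_rem Xl.
apply: (perm_trans pX); rewrite perm_cons perm_to_rem //.
by move: Yl; rewrite (perm_mem pX) inE eq_sym (negPf XY).
Qed.

Lemma conn_swap_mem B X Y X' Y' l : X \in l -> Y \in l -> X != Y ->
  X' \in B -> Y' \in B -> cover_count [:: X; Y] =1 cover_count [:: X'; Y'] ->
  connected_by B l (X' :: Y' :: rem Y (rem X l)).
Proof.
move=> Xl Yl XY X'B Y'B cov.
exact: conn_trans (conn_perm B (perm_rem2 Xl Yl XY)) (conn_swap _ X'B Y'B cov).
Qed.

Lemma conn_mem B D l : D \in l -> exists l', connected_by B l (D :: l').
Proof. by move=> Dl; exists (rem D l); apply/conn_perm/perm_to_rem. Qed.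

(** The inductive step of connectivity: any basis dividing some monomial of the fibre can be made to
    divide the given one. [close_connected] iterates it. *)
Definition reaches B := forall l D l1,
  {subset l <= B} -> D \in B -> {subset l1 <= B} -> size l = (size l1).+1 ->
  cover_count l =1 cover_count (D :: l1) -> exists l', connected_by B l (D :: l').

Lemma cover_sum K l :
  \sum_(X <- l) #|X :&: K| = \sum_(i in K) cover_count l i.
Proof.
elim: l => [|X l IHl]; first by rewrite big_nil big1.
rewrite big_cons IHl -(eq_bigr _ (fun i _ => esym (cover_count_cons X l i))).
rewrite big_split /=; congr (_ + _).
by rewrite -sum1_card big_mkcond [RHS]big_mkcond /=; apply: eq_bigr => i _;
  rewrite inE; case: (i \in X); case: (i \in K).
Qed.

(** Equal coverage means equal total incidence with [K]. On the right it is at most [size l1], as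
    [D] contributes nothing, so the longer list [l] has a member contributing nothing. *)
Lemma cover_avoid (K : {set T}) D l l1 : size l = (size l1).+1 ->
  cover_count l =1 cover_count (D :: l1) -> [disjoint D & K] ->
  {in l1, forall X : {set T}, #|X :&: K| <= 1} ->
  exists2 X, X \in l & [disjoint X & K].
Proof.
move=> szl cov DK l1K; apply/hasP; apply: contraPT (leqnn (size l1)).
rewrite -all_predC => /allP lK; apply/negP; rewrite -ltnNge -szl.
rewrite -!sum1_size; apply: leq_trans (_ : \sum_(X <- l1) #|X :&: K| <= _).
  have DK0 : #|D :&: K| = 0 by apply/eqP; rewrite cards_eq0 setI_eq0.
  have <- : \sum_(X <- D :: l1) #|X :&: K| = \sum_(X <- l1) #|X :&: K|.
    by rewrite big_cons DK0.
  rewrite (cover_sum K (D :: l1)) -(eq_bigr _ (fun i _ => cov i)) -cover_sum.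
  rewrite big_seq [leqRHS]big_seq; apply: leq_sum => X /lK /=.
  by rewrite -setI_eq0 -cards_eq0 -lt0n.
by rewrite big_seq [leqRHS]big_seq; apply: leq_sum => X /l1K.
Qed.

Lemma cover_has l i : 0 < cover_count l i -> exists2 X, X \in l & i \in X.
Proof. by rewrite -has_count => /hasP. Qed.

Lemma cover_hasn l i : cover_count l i < size l -> exists2 X, X \in l & i \notin X.
Proof.
move=> lt; apply/hasP; rewrite (has_predC (fun X : {set T} => i \in X)) all_count.
by rewrite neq_ltn lt.
Qed.

Lemma pair_cover X Y X' Y' : X :&: Y = X' :&: Y' -> X :|: Y = X' :|: Y' ->
  cover_count [:: X; Y] =1 cover_count [:: X'; Y'].
Proof.
move=> /setP I /setP U i; have := I i; have := U i.
rewrite /cover_count /= !inE.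
by case: (i \in X); case: (i \in Y); case: (i \in X'); case: (i \in Y').
Qed.

(** * Bases within one exchange of a fixed set *)

Section Star.
Variables (B : {set {set T}}) (Z : {set T}).
Hypothesis exB : exchange B.
Hypothesis nearB : forall X, X \in B -> #|X| = #|Z| /\ #|X :\: Z| <= 1.

Lemma star_set X a e : X \in B -> a \in X -> a \notin Z -> e \in Z -> e \notin X ->
  X = a |: (Z :\ e).
Proof.
move=> /nearB[cX dX] aX aZ eZ eX; apply/eqP.
rewrite eqEcard cardsU1 !inE (negPf aZ) andbF cX (cardsD1 e Z) eZ leqnn andbT.
apply/subsetP=> z zX; rewrite !inE; have [//|za /=] := eqVneq z a.
have -> /= : z != e by apply: contraNneq eX => <-.
apply: contraTT dX => zZ; rewrite -ltnNge.
apply: leq_trans (_ : #|[set z; a]| <= _); first by rewrite cards2 za.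
by apply: subset_leq_card; rewrite subUset !sub1set !inE zX aX zZ aZ.
Qed.

(** Bases other than [Z] are pairs of an entering and a leaving element. Exchanging [e'] out of the
    second basis brings in [a] or [e], but [a] beside [a'] would give two elements outside [Z]. *)
Lemma star_rect a a' e e' : a \notin Z -> a' \notin Z -> e \in Z -> e' \in Z ->
  a != a' -> e != e' ->
  a |: (Z :\ e') \in B -> a' |: (Z :\ e) \in B -> a' |: (Z :\ e') \in B.
Proof.
move=> aZ a'Z eZ e'Z aa' ee' XB YB.
have na'e' : a' != e' by apply: contraNneq a'Z => ->.
have na'e : a' != e by apply: contraNneq a'Z => ->.
have nae' : a != e' by apply: contraNneq aZ => ->.
have e'Ze : e' \in Z :\ e by rewrite !inE e'Z eq_sym ee'.
rewrite -(setD1K e'Ze) setU1CA in YB.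
have [||y [y_in ye' yS yB]] := exchangeU exB _ YB XB.
- by rewrite !inE negb_or eqxx andbT eq_sym na'e'.
- by rewrite !inE eqxx /= orbF eq_sym.
have [ya|ya] := eqVneq y a.
  have [_] := nearB yB; rewrite ya leqNgt => /negP[].
  apply: leq_trans (_ : #|[set a; a']| <= _); first by rewrite cards2 aa'.
  by apply: subset_leq_card; rewrite subUset !sub1set !inE !eqxx orbT aZ a'Z.
move: y_in yS; rewrite !inE (negPf ya) ye' /= => yZ; rewrite yZ andbT negb_or negbK.
case/andP=> _ /eqP ye; move: yB; rewrite ye setU1CA.
suff -> : e |: ((Z :\ e) :\ e') = Z :\ e' by [].
apply/setP=> z; rewrite !inE; have [->|//] := eqVneq z e; by rewrite ee' eZ.
Qed.

Lemma star_reaches : reaches B.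
Proof.
move=> l D l1 lB DB l1B szl cov.
have [Dl|Dl] := boolP (D \in l); first exact: conn_mem.
have eqB X Y : X \in B -> Y \in B -> X \subset Y -> X = Y.
  move=> XB YB sXY; apply/eqP; rewrite eqEcard sXY.
  by rewrite (nearB XB).1 (nearB YB).1 leqnn.
have [DZ|/subsetPn[a aD aZ]] := boolP (D \subset Z).
  have DE : D = Z by apply/eqP; rewrite eqEcard DZ (nearB DB).1 leqnn.
  have [||X Xl XZ] := cover_avoid (K := ~: Z) szl cov.
  - by rewrite -subsets_disjoint.
  - by move=> X /l1B/nearB[_]; rewrite setDE.
  case/negP: Dl; suff -> : D = X by [].
  by apply/esym/eqB => //; [apply: lB|rewrite DE subsets_disjoint].
have [e eZ eD] : exists2 e, e \in Z & e \notin D.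
  apply/subsetPn; apply: contra aZ => sZD.
  by have -> : Z = D by apply/eqP; rewrite eqEcard sZD (nearB DB).1 leqnn.
have DE := star_set DB aD aZ eZ eD.
have [X Xl aX] : exists2 X, X \in l & a \in X.
  by apply: cover_has; rewrite cov cover_count_cons aD.
(* Since [D] omits [e], at most [size l1] members of the target list contain [e], fewer than
   [size l]. *)
have [Y Yl eY] : exists2 Y, Y \in l & e \notin Y.
  apply: cover_hasn; rewrite cov cover_count_cons (negPf eD) szl ltnS.
  exact: count_size.
have XB := lB _ Xl; have YB := lB _ Yl.
have eX : e \in X.
  by apply: contraNT Dl => eX; rewrite DE -(star_set XB aX aZ eZ eX).
have [e' e'Z e'X] : exists2 e', e' \in Z & e' \notin X.
  apply/subsetPn; apply: contra aZ => sZX.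
  by have -> : Z = X by apply/eqP; rewrite eqEcard sZX (nearB XB).1 leqnn.
have [a' a'Y a'Z] : exists2 a', a' \in Y & a' \notin Z.
  apply/subsetPn; apply: contra eY => sYZ.
  by have -> : Y = Z by apply/eqP; rewrite eqEcard sYZ (nearB YB).1 leqnn.
have XE := star_set XB aX aZ e'Z e'X; have YE := star_set YB a'Y a'Z eZ eY.
have ee' : e != e' by apply: contraNneq e'X => <-.
have aa' : a != a' by apply: contraNneq Dl => E; rewrite DE E -YE.
have X'B : a' |: (Z :\ e') \in B
  by apply: (star_rect aZ a'Z eZ e'Z aa' ee'); rewrite -?XE -?YE.
eexists; apply: (conn_swap_mem Xl Yl _ DB X'B).
  by apply: contraNneq eY => <-.
apply: pair_cover; rewrite DE XE YE; apply/setP=> z; rewrite !inE.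
  have [->|_] := eqVneq z a; first by rewrite (negPf aZ) (negPf aa') !andbF.
  have [->|_] := eqVneq z a'; first by rewrite (negPf a'Z) !andbF.
  by case: (z \in Z); case: (z == e); case: (z == e').
by case: (z == a); case: (z == a'); case: (z == e); case: (z == e'); case: (z \in Z).
Qed.

End Star.

(** * Bases containing a common core: the graph of a rank two matroid *)

Section Cone.
Variables (B : {set {set T}}) (C : {set T}).
Hypothesis exB : exchange B.
Hypothesis coneB : forall X, X \in B -> C \subset X /\ #|X| = #|C|.+2.

Let edge u v := u |: (v |: C) \in B.

Lemma edgeC u v : edge u v = edge v u.
Proof. by rewrite /edge setU1CA. Qed.

Lemma edgeP u v : edge u v -> [/\ u != v, u \notin C & v \notin C].
Proof.
move=> /coneB[_] /eqP; rewrite !cardsU1 !inE -[_.+2]add2n addnA eqn_add2r.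
by case: (u == v); case: (u \in C); case: (v \in C).
Qed.

Lemma cone_set X u : X \in B -> u \in X -> u \notin C -> exists v, X = u |: (v |: C).
Proof.
move=> XB uX uC; have [sCX cX] := coneB XB.
have: #|X :\: (u |: C)| == 1.
  rewrite cardsDS ?subUset ?sub1set ?uX // cX cardsU1 uC.
  by rewrite add1n subSS subSn // subnn.
case/cards1P=> v vE; exists v; apply/setP=> z; have /setP/(_ z) := vE.
have sz : z \in C -> z \in X by apply: (subsetP sCX).
rewrite !inE; have [->|_] := eqVneq z u; first by rewrite uX.
by case: (z \in C) sz => [/(_ isT)-> _|_ <-]; rewrite ?orbT ?orbF.
Qed.

(** In rank two, non-adjacency of non-loops is parallelism, and [x] cannot be parallel to both ends
    of an edge. The exchange removes [z] from [xz]. *)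
Lemma cone_rank2 u v x z : edge u v -> edge x z -> edge u x \/ edge v x.
Proof.
move=> uv xz; have [nuv uC vC] := edgeP uv; have [nxz xC zC] := edgeP xz.
have [->|xu] := eqVneq x u; first by right; rewrite edgeC.
have [->|xv] := eqVneq x v; first by left.
have [<-|zu] := eqVneq z u; first by left; rewrite edgeC.
have [<-|zv] := eqVneq z v; first by right; rewrite edgeC.
rewrite edgeC in xz.
have [||y [y_in yz yS yB]] := exchangeU exB _ xz uv; [by neqs|by neqs|].
move: yS; rewrite inE negb_or => /andP[yx yC].
by case: (in_setU2 y_in yC) yB => ->; [left|right].
Qed.

Lemma cone_out X : X \in B -> exists2 a, a \in X & a \notin C.
Proof.
move=> /coneB[_ cX]; apply/subsetPn; apply/negP=> /subset_leq_card.
by rewrite cX ltnNge leqnSn.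
Qed.

Lemma edge_mem u v i : edge u v ->
  (i \in u |: (v |: C)) = (i == u) + (i == v) + (i \in C) :> nat.
Proof.
move=> /edgeP[uv uC vC]; rewrite !inE.
have [->|_] := eqVneq i u; first by rewrite (negPf uv) (negPf uC).
by have [->|_] := eqVneq i v; first by rewrite (negPf vC).
Qed.

Lemma swap_cover u v x z : edge u v -> edge x z -> edge u x -> edge v z ->
  cover_count [:: u |: (v |: C); x |: (z |: C)] =1
  cover_count [:: u |: (x |: C); v |: (z |: C)].
Proof.
move=> uv xz ux vz i; rewrite !cover_count_cons !edge_mem //.
lia.
Qed.

(* With [D] = C+ab, [X] = C+ax and [Y] = C+by, a direct swap fails only if [x] and
   [y] are parallel.  Counting the members that meet the parallel class [K] of [x]
   then yields a basis [V] avoiding it, and two swaps through [V] produce [D]. *)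
Lemma cone_reaches : reaches B.
Proof.
move=> l D l1 lB DB l1B szl cov.
have [Dl|Dl] := boolP (D \in l); first exact: conn_mem.
have [a aD aC] : exists2 a, a \in D & a \notin C.
  exact: cone_out.
have [b DE] := cone_set DB aD aC.
have ab : edge a b by rewrite /edge -DE.
have [nab _ bC] := edgeP ab.
have bD : b \in D by rewrite DE !inE eqxx orbT.
have [X Xl aX] : exists2 X, X \in l & a \in X.
  by apply: cover_has; rewrite cov cover_count_cons aD.
have [Y Yl bY] : exists2 Y, Y \in l & b \in Y.
  by apply: cover_has; rewrite cov cover_count_cons bD.
have [x XE] := cone_set (lB _ Xl) aX aC; have [y YE] := cone_set (lB _ Yl) bY bC.
have ax : edge a x by rewrite /edge -XE lB.
have by_ : edge b y by rewrite /edge -YE lB.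
have [nax _ xC] := edgeP ax; have [nby _ yC] := edgeP by_.
have XY : X != Y.
  apply: contraNneq Dl => E; suff -> : D = X by [].
  have: b \in X by rewrite E.
  by rewrite XE DE !inE eq_sym (negPf nab) (negPf bC) orbF => /eqP->.
have [xy|nxy] := boolP (edge x y).
  by eexists; apply: (conn_swap_mem Xl Yl XY DB xy); rewrite XE YE DE;
    apply: swap_cover.
(* Besides the parallel class of [x] this contains the loops. By [cone_rank2] one end of every edge
   is adjacent to [x], so an edge meets [K] at most once. *)
pose K := [set w in ~: C | ~~ edge w x].
have KP u v : edge u v -> [|| edge u x | edge v x].
  by move=> uv; apply/orP/(cone_rank2 uv); rewrite edgeC; exact: ax.
have edgeK u v : edge u v -> #|(u |: (v |: C)) :&: K| <= 1.
  move=> uv; have [_ uC vC] := edgeP uv.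
  have: (u |: (v |: C)) :&: K \subset if edge u x then [set v] else [set u].
    apply/subsetP=> w; rewrite !inE => /and3P[wuv wC wx].
    move: wuv; rewrite (negPf wC) orbF => wuv.
    have := KP _ _ uv; case: ifPn => ux; rewrite !inE /=.
      by case/orP: wuv => // /eqP wu; rewrite wu ux in wx.
    by move=> vx; case/orP: wuv => // /eqP wv; rewrite wv vx in wx.
  by move/subset_leq_card => /leq_trans-> //; case: ifP; rewrite cards1.
have byx : edge b x.
  have := KP _ _ by_; rewrite (edgeC y) (negPf nxy) orbF //.
have [||V Vl VK] := cover_avoid (K := K) szl cov.
- rewrite DE -setI_eq0; apply/eqP/setP=> w; rewrite !inE.
  have [->|_] := eqVneq w a; first by rewrite ax andbF.
  have [->|_] := eqVneq w b; first by rewrite byx andbF.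
  by rewrite /=; case: (w \in C).
- move=> W /l1B WB; have [w wW wC] : exists2 w, w \in W & w \notin C.
    exact: cone_out.
  have [w' WE] := cone_set WB wW wC.
  by rewrite WE edgeK // /edge -WE.
have VB := lB _ Vl.
have notK w : w \in V -> w \notin C -> edge w x.
  move=> wV wC; have /pred0P/(_ w)/negbT := VK.
  by rewrite /= wV !inE wC negbK.
have xV : x \notin V.
  apply/negP => xV; have /edgeP[] := notK x xV xC; by rewrite eqxx.
have yV : y \notin V.
  by apply/negP => yV; have := notK y yV yC; rewrite edgeC (negPf nxy).
have [u0 u0V u0C] : exists2 w, w \in V & w \notin C.
  exact: cone_out.
have [v0 VE0] := cone_set VB u0V u0C.
have [u [v [VE av]]] : exists u v, V = v |: (u |: C) /\ edge a v.
  have uv : edge u0 v0 by rewrite /edge -VE0.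
  have [ua|va] := cone_rank2 uv ax.
    by exists v0, u0; rewrite edgeC ua.
  by exists u0, v0; rewrite edgeC va VE0 setU1CA.
have vu : edge v u by rewrite /edge -VE.
have [nvu vC uC] := edgeP vu.
have ux : edge u x by apply: notK => //; rewrite VE !inE eqxx orbT.
have vx : edge v x by apply: notK => //; rewrite VE !inE eqxx.
have vy : edge v y.
  have yb : edge y b by rewrite edgeC.
  by have [//|] := cone_rank2 vx yb; rewrite (negPf nxy).
have XV : X != V by apply: contraNneq xV => <-; rewrite XE !inE eqxx orbT.
have YV : Y != V by apply: contraNneq yV => <-; rewrite YE !inE eqxx orbT.
have xu : edge x u by rewrite edgeC.
(* First [ax], [vu] become [av], [xu]; then [av], [by] become [ab], [vy]. *)
have covXV : cover_count [:: X; V] =1 cover_count [:: a |: (v |: C); x |: (u |: C)].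
  by rewrite XE VE; apply: swap_cover => //; rewrite ?(edgeC x).
have H1 := conn_swap_mem Xl Vl XV av xu covXV.
set l2 := (a |: (v |: C)) :: (x |: (u |: C)) :: rem V (rem X l) in H1.
have Yl2 : Y \in l2.
  have := Yl; rewrite (perm_mem (perm_rem2 Xl Vl XV)) !inE.
  by rewrite (negPf YV) eq_sym (negPf XY) /= => ->; rewrite !orbT.
have avY : a |: (v |: C) != Y.
  have yY : y \in Y by rewrite YE !inE eqxx orbT.
  apply: contraTneq yY => <-; rewrite !inE !negb_or yC andbT.
  by apply/andP; split; apply: contraNneq nxy => ->; rewrite edgeC.
have covavY : cover_count [:: a |: (v |: C); Y] =1 cover_count [:: D; v |: (y |: C)].
  by rewrite DE YE; apply: swap_cover.
have avl2 : a |: (v |: C) \in l2 by rewrite mem_head.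
by eexists; apply: conn_trans H1 (conn_swap_mem avl2 Yl2 avY DB vy covavY).
Qed.

End Cone.
Lemma mem_setC B X : (X \in [set ~: Y | Y in B]) = (~: X \in B).
Proof.
by apply/imsetP/idP => [[Y YB ->]|XB]; rewrite ?setCK //; exists (~: X); rewrite ?setCK.
Qed.

(** Under complementation, the entering element of a basis becomes the leaving one, so this is
    [dual_exchange]. *)
Lemma exchange_setC B : exchange B -> close B -> exchange [set ~: X | X in B].
Proof.
move=> exB clB X Y; rewrite !mem_setC => XB YB x; rewrite inE => /andP[xY xX].
have [||y [yX yY yB]] := dual_exchange exB clB XB YB (q := x).
- by rewrite inE.
- by rewrite inE negbK.
rewrite !inE negbK in yX yY; exists y; first by rewrite inE yX.
rewrite mem_setC; suff -> : ~: (y |: (X :\ x)) = x |: (~: X :\ y) by [].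
apply/setP=> z; rewrite !inE negb_or negb_and negbK.
have [->|_] := eqVneq z x; last by [].
by rewrite xX /= andbT; apply: contraNneq xY => ->.
Qed.

Lemma cover_count_setC l i : cover_count (map (@setC T) l) i = size l - cover_count l i.
Proof.
rewrite /cover_count count_map -(count_predC (fun X : {set T} => i \in X) l).
by rewrite addKn; apply: eq_count => X /=; rewrite inE.
Qed.

Lemma conn_setC B l l' : connected_by [set ~: X | X in B] l l' ->
  connected_by B (map (@setC T) l) (map (@setC T) l').
Proof.
elim=> [{}l {}l' pl|X Y X' Y' {}l X'B Y'B cov|l1 l2 l3 _ H12 _ H23].
- by apply: conn_perm; rewrite perm_map.
- rewrite /= ; apply: conn_swap; rewrite -?mem_setC // => i.
  by rewrite -/(map _ [:: X; Y]) -/(map _ [:: X'; Y']) !cover_count_setC cov.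
exact: conn_trans H12 H23.
Qed.

(** Complementing turns a coverage into the list size minus it, so with equal sizes equal coverages
    stay equal. *)
Lemma reaches_setC B : reaches [set ~: X | X in B] -> reaches B.
Proof.
move=> rB l D l1 lB DB l1B szl cov.
have [|||||l' conn] := rB (map (@setC T) l) (~: D) (map (@setC T) l1).
- by move=> _ /mapP[X Xl ->]; rewrite mem_setC setCK lB.
- by rewrite mem_setC setCK.
- by move=> _ /mapP[X Xl ->]; rewrite mem_setC setCK l1B.
- by rewrite !size_map.
- by move=> i; rewrite -map_cons !cover_count_setC cov szl.
exists (map (@setC T) l'); have := conn_setC conn.
by rewrite /= setCK mapK //; apply: setCK.
Qed.

Lemma close_reaches B : exchange B -> close B -> reaches B.
Proof.
move=> exB clB.
have [->|B0] := eqVneq B set0; first by move=> l D l1 _; rewrite inE.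
have [[C coneB]|[U coconeB]|[Z nearB]] := trichotomy exB clB B0.
- exact: cone_reaches exB coneB.
- apply/reaches_setC/(@cone_reaches _ (~: U)); first exact: exchange_setC.
  move=> X; rewrite mem_setC => /coconeB[sXU cU]; split.
    by rewrite subCset.
  by have := cardsC X; have := cardsC U; lia.
exact: star_reaches exB nearB.
Qed.

(** Total coverage is the length times the common cardinality, which is positive, hence the form
    [r.+1]. *)
Lemma cover_size B r l l' : {in B, forall X, #|X| = r.+1} ->
  {subset l <= B} -> {subset l' <= B} -> cover_count l =1 cover_count l' ->
  size l = size l'.
Proof.
move=> cB lB l'B cov.
have sz s : {subset s <= B} -> \sum_(X <- s) #|X :&: setT| = r.+1 * size s.
  move=> sB; rewrite big_seq (eq_bigr (fun=> r.+1)); last first.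
    by move=> X /sB/cB; rewrite setIT.
  by rewrite -big_seq big_const_seq count_predT iter_addn_0.
apply/eqP; rewrite -(eqn_pmul2l (ltn0Sn r)) -!sz // !cover_sum.
by apply/eqP/eq_bigr => i _.
Qed.

Lemma close_connected B r l l' : exchange B -> close B ->
  {in B, forall X, #|X| = r.+1} -> {subset l <= B} -> {subset l' <= B} ->
  cover_count l =1 cover_count l' -> connected_by B l l'.
Proof.
move=> exB clB cB; elim: l' l => [|D l' IHl] l lB l'B cov.
  have /size0nil -> := cover_size cB lB l'B cov; exact: conn_refl.
have szl := cover_size cB lB l'B cov.
have DB : D \in B by apply: l'B; rewrite mem_head.
have sl'B : {subset l' <= B} by move=> X Xl; apply: l'B; rewrite inE Xl orbT.
have [l1 conn1] := close_reaches exB clB lB DB sl'B szl cov.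
apply: (conn_trans conn1 (conn_cons D _)); apply: IHl => // [X Xl1|i].
  by apply: (conn_all conn1 lB); rewrite inE Xl1 orbT.
by have := conn_cover conn1 i; rewrite cov !cover_count_cons => /addnI.
Qed.

End Reach.

(** * Binary matroids *)

Section Config.
Import GRing.Theory.
Local Open Scope ring_scope.
Variables (F : fieldType) (n d : nat) (A : 'M[F]_(n, d)).
Implicit Types X Y S : {set 'I_n}.
Notation span := (rows_in_mx A).

Lemma row_span i S : row i (span S) = if i \in S then row i A else 0.
Proof. by apply/rowP=> j; rewrite !mxE; case: ifP; rewrite !mxE. Qed.

Lemma row_sub_span i S : i \in S -> (row i A <= span S)%MS.
Proof. by move=> iS; have := row_sub i (span S); rewrite row_span iS. Qed.

Lemma span_sub S m (V : 'M_(m, d)) :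
  (forall i, i \in S -> (row i A <= V)%MS) -> (span S <= V)%MS.
Proof.
by move=> SV; apply/row_subP=> i; rewrite row_span; case: ifP => [/SV|] //; rewrite sub0mx.
Qed.

Lemma span_sub_mx S : (span S <= A)%MS.
Proof. by apply: span_sub => i _; apply: row_sub. Qed.

Lemma span_mono S S' : S \subset S' -> (span S <= span S')%MS.
Proof. by move=> sS; apply: span_sub => i /(subsetP sS); apply: row_sub_span. Qed.

Lemma rank_span S : (\rank (span S) <= #|S|)%N.
Proof.
have le : (span S <= \sum_(i in S) <<row i A>>)%MS.
  by apply: span_sub => i iS; rewrite (sumsmx_sup i) // genmxE.
apply: leq_trans (mxrankS le) _; apply: leq_trans (mxrank_sum_leqif _).1 _.
by rewrite -sum1_card; apply: leq_sum => i _; rewrite /= mxrank_gen rank_leq_row.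
Qed.

Lemma basis_configE X : is_basis_of_config A X = (#|X| == \rank A) && (A <= span X)%MS.
Proof.
rewrite /is_basis_of_config; case: (boolP (A <= _)%MS) => [AX|]; last by rewrite !andbF.
have /eqmxP AE : (span X == A)%MS by rewrite span_sub_mx.
by rewrite AE !andbT eq_sym.
Qed.

Lemma span_coef S (v : 'rV_d) : (v <= span S)%MS ->
  exists u : 'I_n -> F, v = \sum_(i in S) u i *: row i A.
Proof.
case/submxP=> w ->; exists (fun i => w 0 i); rewrite mulmx_sum_row [RHS]big_mkcond /=.
by apply: eq_bigr => i _; rewrite row_span; case: ifP; rewrite ?scaler0.
Qed.

Lemma sum_span S (u : 'I_n -> F) (P : pred 'I_n) : {subset P <= S} ->
  ((\sum_(i | P i) u i *: row i A)%R <= span S)%MS.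
Proof.
by move=> sPS; apply: summx_sub => i Pi; apply/scalemx_sub/row_sub_span/sPS.
Qed.

(* Steinitz replacement, in terms of a coefficient that does not vanish. *)
Lemma span_replace S (u : 'I_n -> F) (v : 'rV_d) j m (V : 'M_(m, d)) :
  v = \sum_(i in S) u i *: row i A -> j \in S -> u j != 0 ->
  (v <= V)%MS -> (span (S :\ j) <= V)%MS -> (row j A <= V)%MS.
Proof.
move=> vE jS uj vV SV; rewrite (bigD1 j) //= in vE.
rewrite -[row j A](scalerK uj) scalemx_sub //.
have -> : u j *: row j A = v - \sum_(i in S | i != j) u i *: row i A.
  by rewrite vE addrK.
rewrite addmx_sub // eqmx_opp; apply: submx_trans SV; apply: sum_span => i.
by rewrite !inE => /andP[iS ->].
Qed.

Lemma basis_rowN X i : is_basis_of_config A X -> i \in X ->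
  ~~ (row i A <= span (X :\ i))%MS.
Proof.
rewrite basis_configE => /andP[/eqP cX AX] iX; apply/negP => ri.
have: (A <= span (X :\ i))%MS.
  apply: submx_trans AX _; apply: span_sub => j jX.
  have [->//|ji] := eqVneq j i; by apply: row_sub_span; rewrite !inE ji.
move/mxrankS/leq_trans/(_ (rank_span _)).
by rewrite -cX (cardsD1 i X) iX ltnn.
Qed.

Lemma basis_swap X x y : is_basis_of_config A X -> x \in X -> y \notin X ->
  (row x A <= span (y |: (X :\ x)))%MS -> is_basis_of_config A (y |: (X :\ x)).
Proof.
rewrite !basis_configE => /andP[/eqP cX AX] xX yX rx.
rewrite -cX cardsU1 !inE (negPf yX) andbF (cardsD1 x X) xX eqxx /=.
apply: submx_trans AX _; apply: span_sub => j jX.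
by have [->//|jx] := eqVneq j x; apply: row_sub_span; rewrite !inE jx jX orbT.
Qed.

(** Expand [x] over [Y]. As [x] is not in the span of [X - x], some [y] with nonzero coefficient is
    not either. The coefficient lets [x] replace [y] in [Y]; lying outside the span lets [y] replace
    [x] in [X]. *)
Lemma config_sym_exchange X Y x :
  is_basis_of_config A X -> is_basis_of_config A Y -> x \in X -> x \notin Y ->
  exists y, [/\ y \in Y, y \notin X, is_basis_of_config A (y |: (X :\ x)) &
                is_basis_of_config A (x |: (Y :\ y))].
Proof.
move=> bX bY xX xY.
have AX : (A <= span X)%MS by move: bX; rewrite basis_configE => /andP[].
have AY : (A <= span Y)%MS by move: bY; rewrite basis_configE => /andP[].
have [u xE] := span_coef (submx_trans (row_sub x A) AY).
have [y /and3P[yY uy yX]] :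
    exists y, [&& y \in Y, u y != 0 & ~~ (row y A <= span (X :\ x))%MS].
  apply/existsP; apply: contraR (basis_rowN bX xX); rewrite negb_exists => /forallP none.
  rewrite xE; apply: summx_sub => i iY; have := none i; rewrite iY /= negb_and !negbK.
  by case/orP=> [/eqP->|ri]; rewrite ?scale0r ?sub0mx // scalemx_sub.
have nyx : y != x by apply: contraNneq xY => <-.
have yX' : y \notin X.
  by apply: contra yX => yX'; apply: row_sub_span; rewrite !inE nyx.
exists y; split=> //.
  apply: basis_swap => //; have [w yE] := span_coef (submx_trans (row_sub y A) AX).
  have wx : w x != 0.
    apply: contraNneq yX => wx; rewrite yE (bigD1 x) //= wx scale0r add0r.
    by apply: sum_span => i; rewrite !inE => /andP[-> ->].
  apply: (span_replace yE xX wx); first by rewrite row_sub_span ?setU11.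
  by apply: span_mono; apply: subsetUr.
apply: basis_swap => //; apply: (span_replace xE yY uy).
  by rewrite row_sub_span ?setU11.
by apply: span_mono; apply: subsetUr.
Qed.

End Config.

Section Binary.
Import GRing.Theory.
Local Open Scope ring_scope.
Variable n : nat.
Implicit Types (B : {set {set 'I_n}}) (X : {set 'I_n}).

Lemma represents_sym_exchange (F : fieldType) B : represents F B ->
  forall X Y x, X \in B -> Y \in B -> x \in X -> x \notin Y ->
  exists y, [/\ y \in Y, y \notin X, y |: (X :\ x) \in B & x |: (Y :\ y) \in B].
Proof.
move=> [d [A BE]] X Y x; rewrite !BE => bX bY xX xY.
have [y [yY yX ? ?]] := config_sym_exchange bX bY xX xY.
by exists y; rewrite !BE.
Qed.

Lemma represents_exchange (F : fieldType) B : represents F B -> exchange B.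
Proof.
move=> rB X Y XB YB x; rewrite inE => /andP[xY xX].
have [y [yY yX yB _]] := represents_sym_exchange rB XB YB xX xY.
by exists y; rewrite // inE yX.
Qed.

Lemma F2_neq0 (x : 'F_2) : x != 0 -> x = 1.
Proof. by case: x => [[|[|?]] ?] // _; apply/val_inj. Qed.

(** Modulo the span of [C], both [c] and [e] are combinations of [a] and [b] with nonzero
    coefficients. Over the field with two elements both are [a + b], so [c] and [e] agree there, and
    [C + ce] is not a basis. *)
Lemma binary_no_U24 B : binary_matroid B -> no_U24 B.
Proof.
move=> [d [A BE]] C a b c e U aC bC cC eC; rewrite !BE.
move: U; rewrite /= !inE !negb_or !andbT.
move=> /and3P[/and3P[ab ac ae] /andP[bc be] ce] abB ceB acB beB aeB bcB.
have coef x : x \notin C -> x != a -> x != b -> is_basis_of_config A (a |: (x |: C)) ->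
    is_basis_of_config A (b |: (x |: C)) ->
    exists2 w : 'rV_d, (w <= rows_in_mx A C)%MS & row x A = row a A + row b A + w.
  move=> xC xa xb axB bxB.
  have AX : (A <= rows_in_mx A (a |: (b |: C)))%MS.
    by move: abB; rewrite basis_configE => /andP[].
  have [u xE] := span_coef (submx_trans (row_sub x A) AX).
  rewrite big_setU1 ?big_setU1 /= ?inE ?negb_or ?ab ?aC // in xE.
  pose w := \sum_(i in C) u i *: row i A.
  have wC : (w <= rows_in_mx A C)%MS by apply: sum_span.
  have inC y : y \notin C -> (w <= rows_in_mx A (y |: C))%MS.
    by move=> yC; apply: submx_trans wC (span_mono _ (subsetUr _ _)).
  have dropx y : x != y -> (y |: (x |: C)) :\ x = y |: C.
    by move=> xy; rewrite setU1CA setU1K // !inE negb_or xy.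
  have ua : u a = 1.
    apply: F2_neq0; apply: contraNneq (basis_rowN bxB (_ : x \in _)) => [ua|].
      by rewrite dropx // xE ua scale0r add0r addmx_sub ?inC // scalemx_sub ?row_sub_span ?setU11.
    by rewrite !inE eqxx orbT.
  have ub : u b = 1.
    apply: F2_neq0; apply: contraNneq (basis_rowN axB (_ : x \in _)) => [ub|].
      rewrite dropx // xE ub scale0r add0r addmx_sub ?inC // scalemx_sub ?row_sub_span ?setU11 //.
    by rewrite !inE eqxx orbT.
  by exists w => //; rewrite xE ua ub !scale1r addrA.
have [w wC cE] : exists2 w : 'rV_d, (w <= rows_in_mx A C)%MS & row c A = row a A + row b A + w.
  by apply: coef => //; rewrite eq_sym.
have [w' w'C eE] : exists2 w : 'rV_d, (w <= rows_in_mx A C)%MS & row e A = row a A + row b A + w.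
  by apply: coef => //; rewrite eq_sym.
have cS : c \in c |: (e |: C) by rewrite setU11.
case/negP: (basis_rowN ceB cS); rewrite setU1K; last by rewrite !inE negb_or ce.
have -> : row c A = row e A + (w - w').
  by rewrite cE eE addrACA subrr addr0.
have sC : (rows_in_mx A C <= rows_in_mx A (e |: C))%MS by apply/span_mono/subsetUr.
rewrite addmx_sub ?row_sub_span ?setU11 // addmx_sub ?eqmx_opp //.
  exact: submx_trans wC sC.
exact: submx_trans w'C sC.
Qed.

Section FundamentalMatrix.
Variables (F : fieldType) (X : {set 'I_n}) (N : 'I_n -> 'I_n -> bool).

(** The standard form with an identity block and a block [N], transposed: rows are the elements,
    columns the members of [X]. *)
Definition fundamental_mx : 'M[F]_(n, #|X|) :=
  \matrix_(i, j) (if i \in X then i == enum_val j else N (enum_val j) i)%:R.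

Lemma fundamental_row i : i \in X ->
  exists j, enum_val j = i /\ row i fundamental_mx = delta_mx 0 j.
Proof.
move=> iX; exists (enum_rank_in iX i); split; first exact: enum_rankK_in.
move: (enum_rank_in _ _) (enum_rankK_in iX iX) => j <-.
by apply/rowP=> k; rewrite !mxE enum_valP eqxx (inj_eq enum_val_inj) eq_sym.
Qed.

Lemma fundamental_span : (1%:M <= rows_in_mx fundamental_mx X)%MS.
Proof.
apply/row_subP=> j; rewrite row1.
have jX : enum_val j \in X by exact: enum_valP.
have [j' [/enum_val_inj -> <-]] := fundamental_row jX.
exact: row_sub_span.
Qed.

Lemma fundamental_basis : is_basis_of_config fundamental_mx X.
Proof.
rewrite basis_configE (submx_trans (submx1 _) fundamental_span) andbT.
rewrite eqn_leq rank_leq_col andbT.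
by rewrite -[leqLHS](mxrank1 F) mxrankS // (submx_trans fundamental_span) ?span_sub_mx.
Qed.

Lemma fundamental_swap x y : x \in X -> y \notin X ->
  is_basis_of_config fundamental_mx (y |: (X :\ x)) = N x y.
Proof.
move=> xX yX; have [j [jE rx]] := fundamental_row xX.
set A := fundamental_mx in rx *; set Y := y |: _.
apply/idP/idP => [bY|Nxy].
  apply: contraLR isT => Nxy.
  (* If [N x y] is false, every row indexed by [Y] vanishes in the column of [x], where row [x] has
     entry 1. *)
  have col0 : rows_in_mx A Y *m delta_mx j (0 : 'I_1) = 0.
    apply/row_matrixP=> i; rewrite row_mul row_span row0.
    case: ifP => iY; last by rewrite mul0mx.
    apply/rowP=> k; rewrite -colE !mxE.
    move: iY; rewrite !inE => /orP[/eqP->|/andP[ix iX]].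
      by rewrite (negPf yX) jE (negPf Nxy).
    by rewrite iX jE (negPf ix).
  have: (row x A <= rows_in_mx A Y)%MS.
    by move: bY; rewrite basis_configE => /andP[_]; apply: submx_trans (row_sub _ _).
  case/submxP=> w rxE; have := congr1 (mulmx^~ (delta_mx j (0 : 'I_1))) rxE.
  rewrite -mulmxA col0 mulmx0 rx mul_delta_mx => /matrixP/(_ 0 0).
  by rewrite !mxE => /eqP; rewrite oner_eq0.
apply: basis_swap => //; first exact: fundamental_basis.
have yE : row y A = \sum_(i in X) (N i y)%:R *: row i A.
  apply/rowP=> k; rewrite summxE !mxE (negPf yX).
  rewrite (bigD1 (enum_val k)) ?enum_valP //= big1 ?addr0 => [|i /andP[iX ik]].
    by rewrite !mxE enum_valP eqxx mulr1.
  by rewrite !mxE iX (negPf ik) mulr0.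
apply: (span_replace yE xX); first by rewrite Nxy oner_eq0.
  by rewrite row_sub_span ?setU11.
by apply/span_mono/subsetUr.
Qed.

End FundamentalMatrix.

(* Tutte's excluded-minor theorem: the binary matroid of the fundamental matrix
   of any basis agrees with [B] near that basis, hence everywhere. *)
Lemma no_U24_binary B : exchange B -> no_U24 B -> B != set0 -> binary_matroid B.
Proof.
move=> exB noB /set0Pn[X XB].
pose N x y := y |: (X :\ x) \in B.
exists #|X|, (fundamental_mx 'F_2 X N).
pose B' := [set Y | is_basis_of_config (fundamental_mx 'F_2 X N) Y].
have rB' : binary_matroid B' by exists #|X|, (fundamental_mx 'F_2 X N) => Y; rewrite inE.
have exB' := represents_exchange rB'; have noB' := binary_no_U24 rB'.
have XB' : X \in B' by rewrite inE fundamental_basis.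
have near : agree_near B B' X.
  by move=> x y xX yX; rewrite inE fundamental_swap.
have near' : agree_near B' B X by move=> x y xX yX; rewrite near.
move=> Y; rewrite -[RHS]in_set -/B'; apply/idP/idP => YB.
  exact: agree_sub near YB.
exact: agree_sub near' YB.
Qed.

End Binary.

(** * Toric ideals *)

Section Ideal.
Import GRing.Theory.
Local Open Scope fset_scope.
Local Open Scope ring_scope.
Variables (R : comNzRingType) (m : nat).
Notation P := {mpoly R[m]}.
Implicit Types (G : {fset P}) (p q : P) (I : P -> Prop).

Lemma ideal_gen0 G : in_ideal_gen G 0.
Proof. by exists (fun=> 0); rewrite big1 // => g _; rewrite mul0r. Qed.

Lemma ideal_genD G p q : in_ideal_gen G p -> in_ideal_gen G q -> in_ideal_gen G (p + q).
Proof.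
move=> [c ->] [c' ->]; exists (fun g => c g + c' g).
by rewrite -big_split /=; apply: eq_bigr => g _; rewrite mulrDl.
Qed.

Lemma ideal_genM G p q : in_ideal_gen G p -> in_ideal_gen G (q * p).
Proof.
move=> [c ->]; exists (fun g => q * c g).
by rewrite big_distrr /=; apply: eq_bigr => g _; rewrite mulrA.
Qed.

Lemma ideal_genN G p : in_ideal_gen G p -> in_ideal_gen G (- p).
Proof. by move/(ideal_genM (-1)); rewrite mulN1r. Qed.

Lemma ideal_gen_mem G g : g \in G -> in_ideal_gen G g.
Proof.
move=> gG; exists (fun h => (h == g)%:R).
rewrite (bigD1_seq g) //= eqxx mul1r big1 ?addr0 // => h hg.
by rewrite (negPf hg) mul0r.
Qed.

Lemma ideal_gen_trans G G' p :
  (forall g, g \in G -> in_ideal_gen G' g) -> in_ideal_gen G p -> in_ideal_gen G' p.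
Proof.
move=> GG' [c ->]; rewrite big_seq; elim/big_ind: _ => [|? ?|g gG].
- exact: ideal_gen0.
- exact: ideal_genD.
- exact/ideal_genM/GG'.
Qed.

Lemma minimal_generators I G : generates I G -> exists2 G' : {fset P}, G' `<=` G &
  generates I G' /\ forall G'' : {fset P}, G'' `<` G' -> ~ generates I G''.
Proof.
have [N] := ubnP #|` G|; elim: N G => // N IHN G leG genG.
have [[G1 [ltG1 genG1]]|minG] :=
  Classical_Prop.classic (exists G1 : {fset P}, G1 `<` G /\ generates I G1).
  have [|G' sG' minG'] := IHN G1 _ genG1.
    by apply: leq_trans (fproper_ltn_card ltG1) _; rewrite -ltnS.
  by exists G' => //; apply: fsubset_trans sG' (fproper_sub ltG1).
exists G => //; split=> // G1 ltG1 genG1; by apply: minG; exists G1.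
Qed.

Lemma generates_sub I G H : generates I G -> (forall h, h \in H -> I h) ->
  (forall g, g \in G -> in_ideal_gen H g) -> generates I H.
Proof.
by move=> [_ genG] HI GH; split=> // p /genG; apply: ideal_gen_trans GH.
Qed.

Lemma minimal_irredundant I G g : generates I G ->
  (forall G' : {fset P}, G' `<` G -> ~ generates I G') -> g \in G ->
  ~ in_ideal_gen (G `\ g) g.
Proof.
move=> genG minG gG redg; apply: (minG (G `\ g)); first by rewrite fproperD1.
apply: (generates_sub genG) => [h|h hG]; first by rewrite !inE => /andP[_ /genG.1].
by have [->//|hg] := eqVneq h g; apply: ideal_gen_mem; rewrite !inE hg.
Qed.

End Ideal.

Section Toric.
Import GRing.Theory.
Local Open Scope ring_scope.
Variables (k : fieldType) (n : nat) (B : {set {set 'I_n}}).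
Notation m := #|B|.
Notation P := {mpoly k[m]}.
Implicit Types (u v w : 'X_{1..m}) (p : P).

Definition basis_of (i : 'I_m) : {set 'I_n} := enum_val i.

Definition weight u : 'X_{1..n} :=
  [multinom (\sum_(i < m) u i * (j \in basis_of i))%N | j < n].

Lemma toric_monomial u : toric_map k B 'X_[u] = 'X_[weight u].
Proof.
rewrite /toric_map comp_mpolyX [RHS]mpolyXE_id.
under [RHS]eq_bigr => j _ do rewrite mnmE -prodrXr.
rewrite [RHS]exchange_big /=; apply: eq_bigr => i _.
rewrite tnth_mktuple -/(basis_of i) -prodrXl big_mkcond /=; apply: eq_bigr => j _.
by case: (j \in _); rewrite ?muln1 ?muln0.
Qed.

Lemma toric_mapB : {morph toric_map k B : p q / p - q}.
Proof. exact: comp_mpolyB. Qed.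

Lemma toric_binomial u v : toric_ideal k B ('X_[u] - 'X_[v]) <-> weight u = weight v.
Proof.
rewrite /toric_ideal toric_mapB !toric_monomial; split=> [/eqP|->]; last exact: subrr.
rewrite subr_eq0 => /eqP/(congr1 (mcoeff (weight u))); rewrite !mcoeffX eqxx.
by case: eqP => // _ /eqP; rewrite oner_eq0.
Qed.

Lemma toric_coef p (w : 'X_{1..n}) : (toric_map k B p)@_w = \sum_(u <- msupp p) p@_u * (weight u == w)%:R.
Proof.
rewrite /toric_map comp_mpolyEX raddf_sum /=; apply: eq_bigr => u _.
by rewrite mcoeffZ -[_ \mPo _]/(toric_map k B _) toric_monomial mcoeffX.
Qed.

(* Any two monomials of the same weight can be cancelled against each other, so
   a polynomial of the toric ideal is reduced to [0] by shrinking its support. *)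
Lemma toric_ideal_ind (J : P -> Prop) : J 0 ->
  (forall p q, J p -> J q -> J (p + q)) ->
  (forall (c : k) u v, weight u = weight v -> J (c *: ('X_[u] - 'X_[v]))) ->
  forall p, toric_ideal k B p -> J p.
Proof.
move=> J0 JD JX p; have [N] := ubnP (size (msupp p)).
elim: N p => // N IHN p leN pI.
have [supp0|[u up]] : msupp p = [::] \/ exists u, u \in msupp p.
  by case: (msupp p) => [|u s]; [left|right; exists u; rewrite mem_head].
  by rewrite (msuppnil0 supp0).
have pu : p@_u != 0 by rewrite -mcoeff_msupp.
have [v vp /andP[vu wv]] : exists2 v, v \in msupp p & (v != u) && (weight v == weight u).
  apply/hasP; apply: contraR pu => none.
  have := congr1 (mcoeff (weight u)) (pI : toric_map k B p = 0).
  rewrite toric_coef mcoeff0 (bigD1_seq u) ?msupp_uniq //= eqxx mulr1 big1_seq.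
    by rewrite addr0 => ->; rewrite eqxx.
  move=> v /andP[vu vp]; move/hasPn/(_ v vp): none; rewrite vu /= => /negPf->.
  by rewrite mulr0.
pose q := p@_u *: ('X_[u] - 'X_[v]) : P.
rewrite -[p](subrK q); apply: JD; last by apply: JX; apply/esym/eqP.
apply: IHN; last first.
  rewrite /toric_ideal /toric_map comp_mpolyB comp_mpolyZ.
  have /toric_binomial : weight u = weight v by apply/esym/eqP.
  rewrite /toric_ideal /toric_map => ->; rewrite scaler0 subr0; exact: pI.
have sup : {subset msupp (p - q) <= rem u (msupp p)}.
  move=> w; rewrite mem_rem_uniq ?msupp_uniq // inE !mcoeff_msupp mcoeffB mcoeffZ.
  rewrite mcoeffB !mcoeffX; have [->|wu] := eqVneq w u.
    by rewrite (negPf vu) subr0 mulr1 subrr eqxx.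
  have [<- _|_] := eqVneq v w; first by rewrite -mcoeff_msupp.
  by rewrite subr0 mulr0 subr0.
have := uniq_leq_size (msupp_uniq _) sup; rewrite size_rem // => le.
by apply: leq_ltn_trans le _; rewrite prednK //; case: (msupp p) up.
Qed.

Lemma toric_ideal_gen (G : {fset P}) p :
  (forall u v, weight u = weight v -> in_ideal_gen G ('X_[u] - 'X_[v])) ->
  toric_ideal k B p -> in_ideal_gen G p.
Proof.
move=> GX; apply: toric_ideal_ind p; first exact: ideal_gen0.
  by move=> p q; apply: ideal_genD.
by move=> c u v /GX; rewrite -mul_mpolyC; apply: ideal_genM.
Qed.

(** The bridge to the combinatorial part: equal weight is equal coverage. *)
Lemma weight_list (s : seq 'I_m) j :
  weight (s2m s) j = cover_count (map basis_of s) j.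
Proof.
rewrite mnmE; elim: s => [|i s IHs].
  by rewrite big1 // => i _; rewrite mnmE.
rewrite map_cons cover_count_cons -IHs (bigD1 i) //= [in RHS](bigD1 i) //=.
rewrite !mnmE /= eqxx mulnDl mul1n addnA; congr (_ + _)%N.
by apply: eq_bigr => i' ne; rewrite !mnmE /= eq_sym (negPf ne).
Qed.

Lemma s2mX (s : seq 'I_m) : 'X_[s2m s] = \prod_(i <- s) 'X_i :> P.
Proof.
elim: s => [|i s IHs].
  by rewrite big_nil -mpolyX0; congr 'X_[_]; apply/mnmP => x; rewrite !mnmE.
rewrite big_cons -IHs -mpolyXD; congr 'X_[_]; apply/mnmP => x.
by rewrite !mnmE /=.
Qed.

Lemma mdeg_s2m (s : seq 'I_m) : mdeg (s2m s) = size s.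
Proof.
elim: s => [|i s IHs].
  by rewrite mdegE big1 // => i _; rewrite mnmE.
have -> : s2m (i :: s) = (U_(i) + s2m s)%MM by apply/mnmP => x; rewrite !mnmE /=.
by rewrite mdegD mdeg1 IHs.
Qed.

Lemma mdeg2P u : mdeg u = 2 -> exists i j, u = s2m [:: i; j].
Proof.
rewrite -size_m2s => sz; have := s2mK u.
by case: (m2s u) sz => [|i [|j []]] // _ <-; exists i, j.
Qed.

Section Graded.
Variable r : nat.
Hypothesis cardB : {in B, forall X : {set 'I_n}, #|X| = r.+1}.

Lemma basis_ofP i : basis_of i \in B.
Proof. exact: enum_valP. Qed.

Lemma weight_mdeg u v : weight u = weight v -> mdeg u = mdeg v.
Proof.
rewrite -(s2mK u) -(s2mK v) !mdeg_s2m => /mnmP w.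
have inB s : {subset map basis_of s <= B} by move=> _ /mapP[i _ ->]; apply: basis_ofP.
rewrite -(size_map basis_of) -[RHS](size_map basis_of).
by apply: (cover_size cardB (inB _) (inB _)) => j; rewrite -!weight_list w.
Qed.

Lemma weight_inj_deg1 u v : (mdeg u < 2)%N -> weight u = weight v -> u = v.
Proof.
move=> + w; have dv := weight_mdeg w.
rewrite ltnS leq_eqVlt ltnS leqn0 orbC => /orP[u0|u1].
  have v0 : mdeg v == 0 by rewrite -dv.
  by move: u0 v0; rewrite !mdeg_eq0 => /eqP-> /eqP->.
have v1 : mdeg v == 1 by rewrite -dv.
move/mdeg1P: u1 => [i /eqP uE]; move/mdeg1P: v1 => [j /eqP vE].
rewrite uE vE; congr U_(_)%MM; apply: enum_val_inj; apply/setP => x.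
have /mnmP/(_ x) := w.
have one (l : 'I_m) : U_(l)%MM = s2m [:: l] by apply/mnmP => y; rewrite !mnmE /= addn0 eq_sym.
rewrite uE vE !one !weight_list /cover_count /= !addn0 /basis_of.
by case: (x \in _); case: (x \in _).
Qed.

Lemma toric_low p u : toric_ideal k B p -> (mdeg u < 2)%N -> p@_u = 0.
Proof.
move=> pI; move: p pI u; apply: toric_ideal_ind.
- by move=> u _; rewrite mcoeff0.
- by move=> p q Jp Jq u u2; rewrite mcoeffD Jp ?Jq ?addr0.
move=> c v w vw u u2; rewrite mcoeffZ mcoeffB !mcoeffX.
suff -> : (v == u) = (w == u) by rewrite subrr mulr0.
apply/eqP/eqP => E; move: vw; rewrite E.
  by move/(weight_inj_deg1 u2).
by move/esym/(weight_inj_deg1 u2).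
Qed.

(** By [toric_low] the ideal has no terms of degree below two, so a cofactor contributes in degree
    two only through its constant term. *)
Lemma toric_coef2 p q u : toric_ideal k B p -> mdeg u = 2 ->
  (q * p)@_u = q@_0 * p@_u.
Proof.
move=> pI u2; rewrite mcoeffM.
have lt0 : (mdeg (0%MM : 'X_{1..m}) < (mdeg u).+1)%N by rewrite mdeg0.
rewrite (bigD1 (BMultinom lt0, BMultinom (ltnSn (mdeg u)))) /= ?add0m //.
rewrite big1 ?addr0 // => -[[a ha] [b hb]] /= /andP[/eqP uE ne].
have [b2|b2] := ltnP (mdeg b) 2; first by rewrite (toric_low pI b2) mulr0.
case/negP: ne; have a0 : a = 0%MM.
  apply/eqP; rewrite -mdeg_eq0 -leqn0 -(leq_add2r (mdeg b)) add0n.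
  by rewrite -mdegD -uE u2.
by rewrite -pair_eqE /= !bmeqP /= uE a0 add0m !eqxx.
Qed.

Lemma toric_coef2_sum (G : {fset P}) (c : P -> P) u :
  (forall g, g \in G -> toric_ideal k B g) -> mdeg u = 2 ->
  (\sum_(g <- G) c g * g)@_u = \sum_(g <- G) (c g)@_0 * g@_u.
Proof.
move=> GI u2; rewrite raddf_sum /= big_seq [RHS]big_seq; apply: eq_bigr => g gG.
by rewrite toric_coef2 //; apply: GI.
Qed.

(* The quadratic coefficients of an element of the ideal only involve the
   constant terms of its cofactors, so the quadratic generators joining two
   monomials of the same weight must leave every set separating them. *)
Lemma generates_quadric (G : {fset P}) (S : seq 'X_{1..m}) u v :
  generates (toric_ideal k B) G -> (forall g, g \in G -> is_binomial g) ->
  uniq S -> {in S, forall w, mdeg w = 2} -> weight u = weight v ->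
  u \in S -> v \notin S ->
  exists a b, [/\ a \in S, b \notin S, weight a = weight b &
                 'X_[a] - 'X_[b] \in G \/ 'X_[b] - 'X_[a] \in G].
Proof.
move=> [GI Ggen] binG uS S2 wuv uS' vS.
(* This functional is nonzero on a binomial exactly when [S] separates its monomials. As it is
   nonzero on the binomial of [u] and [v], it is nonzero on some generator. *)
pose L (p : P) := \sum_(w <- S) p@_w.
have LX a b : L ('X_[a] - 'X_[b]) = (a \in S)%:R - (b \in S)%:R.
  have one x : \sum_(w <- S) ('X_[x] : P)@_w = (x \in S)%:R.
    have [xS|xS] := boolP (x \in S).
      rewrite (bigD1_seq x) //= mcoeffX eqxx big1 ?addr0 // => w wx.
      by rewrite mcoeffX eq_sym (negPf wx).
    rewrite big1_seq // => w /andP[_ wS]; rewrite mcoeffX.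
    by case: eqP wS xS => // -> ->.
  by rewrite /L -!one -sumrB; apply: eq_bigr => w _; rewrite mcoeffB.
have [c cE] := Ggen _ (iffRL (toric_binomial u v) wuv).
have /hasP[g gG Lg] : has (fun g => L g != 0) (enum_fset G).
  apply: contraT => /hasPn none.
  have := LX u v; rewrite uS' (negPf vS) subr0 cE /L.
  under eq_big_seq => w wS do rewrite toric_coef2_sum ?S2 //.
  rewrite exchange_big /= big1_seq; first by move/esym/eqP; rewrite oner_eq0.
  move=> g /andP[_ /none]; rewrite negbK => /eqP Lg.
  by rewrite -mulr_sumr -[X in _ * X]/(L g) Lg mulr0.
have [a [b [ab gE]]] := binG _ gG.
have wab : weight a = weight b by apply/toric_binomial; rewrite -gE; apply: GI.
move: Lg gG; rewrite gE LX; have [aS|aS] := boolP (a \in S).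
  have [bS|bS] := boolP (b \in S); first by rewrite subrr eqxx.
  by move=> _ gG; exists a, b; split=> //; left.
have [bS|bS] := boolP (b \in S); last by rewrite subrr eqxx.
by move=> _ gG; exists b, a; split=> //; right.
Qed.

Definition thin_fibres := forall u v w, mdeg u = 2 -> weight u = weight v ->
  weight u = weight w -> [|| u == v, u == w | v == w].

Lemma thin_nu : thin_fibres ->
  (exists2 Q : {fset P}, generates (toric_ideal k B) Q & forall g, g \in Q ->
     exists u v, [/\ mdeg u = 2, u != v, weight u = weight v & g = 'X_[u] - 'X_[v]]) ->
  nu_eq_1 (toric_ideal k B).
Proof.
move=> thin [Q genQ QP].
have [Q' sQ' [genQ' minQ']] := minimal_generators genQ.
have hit (G : {fset P}) u v : generates (toric_ideal k B) G ->
    (forall g, g \in G -> is_binomial g) ->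
    mdeg u = 2 -> u != v -> weight u = weight v ->
    'X_[u] - 'X_[v] \in G \/ 'X_[v] - 'X_[u] \in G.
  move=> genG binG u2 uv wuv.
  have [||||a [b]] := generates_quadric (S := [:: u]) genG binG _ _ wuv.
  - by [].
  - by move=> w; rewrite inE => /eqP->.
  - by rewrite inE.
  - by rewrite inE eq_sym.
  rewrite !inE => -[/eqP-> bu wub].
  have := thin _ _ _ u2 wuv wub; rewrite (negPf uv) eq_sym (negPf bu) /=.
  by move=> /eqP->.
have inQ (G : {fset P}) g : minimal_binomial_gen_set (toric_ideal k B) G -> g \in G ->
    exists u v, [/\ mdeg u = 2, u != v, weight u = weight v & g = 'X_[u] - 'X_[v]].
  move=> [binG genG minG] gG.
  (* Every element of [Q] is, up to sign, a generator in [G]. If [g] is not [good], these all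
     survive its removal, so [g] lies in the ideal of the rest. *)
  pose good (g : P) := exists u v, [/\ mdeg u = 2, u != v, weight u = weight v & g = 'X_[u] - 'X_[v]].
  have [//|ngood] := Classical_Prop.classic (good g).
  case: (minimal_irredundant genG minG gG).
  apply: (ideal_gen_trans _ (genQ.2 _ (genG.1 _ gG))) => q /QP[u [v [u2 uv wuv ->]]].
  have [h|h] := hit G u v genG binG u2 uv wuv.
    apply: ideal_gen_mem; rewrite !inE h andbT; apply/eqP=> E; apply: ngood.
    by exists u, v; rewrite -E.
  rewrite -opprB; apply/ideal_genN/ideal_gen_mem; rewrite !inE h andbT.
  apply/eqP=> E; apply: ngood; exists v, u; split; rewrite // 1?eq_sym //.
  by rewrite -(weight_mdeg wuv).
have minQ : minimal_binomial_gen_set (toric_ideal k B) Q'.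
  split=> // g /(fsubsetP sQ')/QP[u [v [_ uv _ ->]]]; by exists u, v.
exists Q'; split=> // G minG; case: (minG) (minQ) => binG genG _ [binQ _ _].
split=> g gG.
  have [u [v [u2 uv wuv ->]]] := inQ _ _ minQ gG.
  by rewrite opprB; apply: hit.
have [u [v [u2 uv wuv ->]]] := inQ _ _ minG gG.
by rewrite opprB; apply: hit.
Qed.

(** Tree exchange: in a fibre with three monomials, one edge can be replaced by another, giving a
    second minimal generating set. *)
Lemma nu_thin : nu_eq_1 (toric_ideal k B) -> thin_fibres.
Proof.
move=> [G [[binG genG minG] uniqG]] u v w u2 wuv wuw.
apply: contraT; rewrite !negb_or => /and3P[uv uw vw].
have [D DE] : exists D : _ -> _ -> P, forall a b, D a b = 'X_[a] - 'X_[b].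
  by exists (fun a b => 'X_[a] - 'X_[b]).
have DN a b : - D a b = D b a by rewrite !DE opprB.
have ext (H : {fset P}) a b : D a b \in H \/ D b a \in H ->
    exists2 g, g \in H & g = D a b \/ g = D b a.
  by case=> ?; [exists (D a b)|exists (D b a)] => //; [left|right].
have [||||u' [b]] := generates_quadric (S := [:: u]) genG binG _ _ wuv.
- by [].
- by move=> x; rewrite inE => /eqP->.
- by rewrite inE.
- by rewrite inE eq_sym.
rewrite -!DE !inE => -[/eqP-> {u'} bu wub /ext[g gG gE]].
(* The generator [g] joins [u] to [b]. One of [v], [w] lies outside [u], [b], so some generator [g']
   leaves this pair, from [a] to [c]. *)
have [t [tu tb wut]] : exists t, [/\ t != u, t != b & weight u = weight t].
  have [vb|vb] := eqVneq v b; first by exists w; rewrite eq_sym uw eq_sym -vb vw.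
  by exists v; rewrite eq_sym uv vb.
have b2 : mdeg b = 2 by rewrite -(weight_mdeg wub).
have [||||a [c]] := generates_quadric (S := [:: u; b]) genG binG _ _ wut.
- by rewrite /= inE eq_sym bu.
- by move=> x; rewrite !inE => /orP[]/eqP->.
- by rewrite !inE eqxx.
- by rewrite !inE negb_or tu.
rewrite -!DE !inE negb_or => -[aub /andP[cu cb] wac /ext[g' g'G g'E]].
have gc : g@_c = 0.
  case: gE => ->; rewrite DE mcoeffB !mcoeffX;
  by rewrite ![_ == c]eq_sym (negPf cu) (negPf cb) subrr.
have Dc x : x != c -> (D x c)@_c != 0.
  by move=> xc; rewrite DE mcoeffB !mcoeffX eqxx (negPf xc) sub0r oppr_eq0 oner_eq0.
have ac : a != c by case/orP: aub => /eqP->; rewrite eq_sym.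
have [a' [a'c a'E wa'c]] : exists a', [/\ a' != c,
    (a = u /\ a' = b) \/ (a = b /\ a' = u) & weight a' = weight c].
  by case/orP: aub => /eqP aE; [exists b|exists u]; rewrite eq_sym -wac aE;
    split=> //; [left|right].
(* The edge [ub] is replaced by [a'c], where [a'] is the end of it other than [a]. Together with the
   edge [ac] of [g'], it still joins [u] to [b]. *)
pose h := D a' c; pose G1 := (h |` (G `\ g))%fset.
have inG1 x : (x \in G1) = (x == h) || (x != g) && (x \in G).
  by rewrite /G1 in_fset1U in_fsetD1.
have hc : h@_c != 0 by apply: Dc.
have hI : toric_ideal k B h by rewrite /h DE; apply/toric_binomial.
have g'g : g' != g.
  apply/eqP => E; have := Dc a ac; rewrite -E in gc.
  by case: g'E gc => ->; rewrite ?gc ?eqxx // -DN mcoeffN => /eqP; rewrite oppr_eq0 => ->.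
have memG1 x : x \in G -> x != g -> in_ideal_gen G1 x.
  by move=> xG xg; apply: ideal_gen_mem; rewrite inG1 xG xg orbT.
have genac : in_ideal_gen G1 (D a c).
  have := memG1 _ g'G g'g; case: g'E => -> H; first exact: H.
  rewrite -DN; exact: ideal_genN H.
have gena'a : in_ideal_gen G1 (D a' a).
  have -> : D a' a = h + - D a c by rewrite DN /h !DE addrA subrK.
  by apply: ideal_genD (ideal_genN genac); apply: ideal_gen_mem; rewrite inG1 eqxx.
have geng : in_ideal_gen G1 g.
  have genaa' : in_ideal_gen G1 (D a a') by rewrite -DN; exact: ideal_genN gena'a.
  case: a'E gE gena'a genaa' => [[-> ->]|[-> ->]] [->|->] H1 H2;
  by [exact: H1|exact: H2].
have genG1 : generates (toric_ideal k B) G1.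
  apply: (generates_sub genG) => [x|x xG].
    by rewrite inG1 => /orP[/eqP->|/andP[_ /(genG.1 _)]].
  by have [->|xg] := eqVneq x g; [exact: geng|exact: memG1].
have [G2 sG2 [genG2 minG2]] := minimal_generators genG1.
have [|+ _] := uniqG G2.
  split=> // x /(fsubsetP sG2); rewrite inG1 => /orP[/eqP->|/andP[_ /binG //]].
  by exists a', c; split; [|exact: DE].
have gh x : x@_c = 0 -> x != h by apply: contra_eqN => /eqP->.
(* [h] has a nonzero coefficient at [c], unlike [g] and [- g]. The remaining possibility, [- g] in
   [G] without [g], would make [g] redundant in [G]. *)
move=> /(_ g gG)[] /(fsubsetP sG2); rewrite inG1.
  by rewrite (negPf (gh _ gc)) eqxx.
rewrite (negPf (gh (- g) _)) ?mcoeffN ?gc ?oppr0 //= => /andP[ng nG].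
case: (minimal_irredundant genG minG gG); rewrite -[X in in_ideal_gen _ X]opprK.
by apply/ideal_genN/ideal_gen_mem; rewrite in_fsetD1 ng.
Qed.

(* The sum has a single term when [X] is a basis, and is [0] otherwise. *)
Definition basis_monomial (X : {set 'I_n}) : P := \sum_(i | basis_of i == X) 'X_i.

Lemma basis_monomialE i : basis_monomial (basis_of i) = 'X_i.
Proof. by rewrite /basis_monomial (big_pred1 i) // => j; rewrite (inj_eq enum_val_inj). Qed.

Lemma basis_index X : X \in B -> exists i, basis_of i = X.
Proof. by move=> XB; exists (enum_rank_in XB X); apply: enum_rankK_in. Qed.

Definition list_monomial l : P := \prod_(X <- l) basis_monomial X.

Lemma list_monomialE s : list_monomial (map basis_of s) = 'X_[s2m s].
Proof.
by rewrite s2mX /list_monomial big_map; apply: eq_bigr => i _; rewrite basis_monomialE.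
Qed.

(** A swap gives a quadratic binomial, in [Q] or zero, times the monomial of the remaining list;
    transitivity telescopes. *)
Lemma connected_ideal (Q : {fset P}) l l' :
  (forall u v, mdeg u = 2 -> u != v -> weight u = weight v -> 'X_[u] - 'X_[v] \in Q) ->
  connected_by B l l' -> {subset l <= B} ->
  in_ideal_gen Q (list_monomial l - list_monomial l').
Proof.
move=> QP; elim=> [{}l {}l' pl _|X Y X' Y' {}l X'B Y'B cov lB|l1 l2 l3 c12 H12 _ H23 lB].
- by rewrite /list_monomial (perm_big _ pl) subrr; apply: ideal_gen0.
- have [i iX] : exists i, basis_of i = X by apply/basis_index/lB; rewrite mem_head.
  have [j jY] : exists i, basis_of i = Y.
    by apply/basis_index/lB; rewrite !inE eqxx orbT.
  have [i' iX'] := basis_index X'B; have [j' jY'] := basis_index Y'B.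
  have E a b U V : basis_of a = U -> basis_of b = V ->
      list_monomial [:: U, V & l] = list_monomial l * 'X_[s2m [:: a; b]].
    move=> <- <-; rewrite -list_monomialE /list_monomial !big_cons big_nil mulr1.
    by rewrite mulrA mulrC.
  rewrite (E _ _ _ _ iX jY) (E _ _ _ _ iX' jY') -mulrBr; apply: ideal_genM.
  have [->|ne] := eqVneq (s2m [:: i; j]) (s2m [:: i'; j']).
    by rewrite subrr; apply: ideal_gen0.
  apply/ideal_gen_mem/QP => //; first by rewrite mdeg_s2m.
  by apply/mnmP=> x; rewrite !weight_list !map_cons iX jY iX' jY'; apply: cov.
rewrite -(subrKA (list_monomial l2)); apply: ideal_genD; first exact: H12.
by apply: H23; apply: conn_all c12 lB.
Qed.

Lemma quadric_generators : exchange B -> close B ->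
  exists2 Q : {fset P}, generates (toric_ideal k B) Q & forall g, g \in Q ->
     exists u v, [/\ mdeg u = 2, u != v, weight u = weight v & g = 'X_[u] - 'X_[v]].
Proof.
move=> exB clB.
pose pm (t : 'I_m * 'I_m) := s2m [:: t.1; t.2].
pose ok (t : ('I_m * 'I_m) * ('I_m * 'I_m)) :=
  (pm t.1 != pm t.2) && (weight (pm t.1) == weight (pm t.2)).
pose Qs : seq P := [seq 'X_[pm t.1] - 'X_[pm t.2] | t <- enum ok].
pose Q := [fset g in Qs]%fset.
have QP g : g \in Q -> exists u v,
    [/\ mdeg u = 2, u != v, weight u = weight v & g = 'X_[u] - 'X_[v]].
  rewrite inE => /mapP[t]; rewrite mem_enum => /andP[ne /eqP wE] ->.
  by exists (pm t.1), (pm t.2); rewrite mdeg_s2m.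
exists Q => //; split=> [g /QP[u [v [_ _ wE ->]]]|p]; first exact/toric_binomial.
apply: toric_ideal_gen => u v wE; rewrite -(s2mK u) -(s2mK v) -!list_monomialE.
have inB s : {subset map basis_of s <= B} by move=> _ /mapP[i _ ->]; apply: basis_ofP.
apply: connected_ideal (inB _).
  move=> a b a2 ab wab; have b2 : mdeg b = 2 by rewrite -(weight_mdeg wab).
  have [i [j aE]] := mdeg2P a2; have [i' [j' bE]] := mdeg2P b2.
  rewrite inE; apply/mapP; exists ((i, j), (i', j')).
    by rewrite mem_enum /in_mem /= /ok /pm /= -aE -bE ab wab eqxx.
  by rewrite /pm /= -aE -bE.
apply: close_connected exB clB cardB (inB _) (inB _) _ => j.
by rewrite -!weight_list !s2mK wE.
Qed.

Lemma weight_pair i j i' j' : weight (s2m [:: i; j]) = weight (s2m [:: i'; j']) <->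
  cover_count [:: basis_of i; basis_of j] =1 cover_count [:: basis_of i'; basis_of j'].
Proof.
split=> [/mnmP w x|cov]; first by have := w x; rewrite !weight_list.
by apply/mnmP=> x; rewrite !weight_list cov.
Qed.

Lemma s2m_swap (i j : 'I_m) : s2m [:: i; j] = s2m [:: j; i].
Proof. by apply/mnmP=> x; rewrite !mnmE /= addnCA. Qed.

Lemma basis_of_inj i j : basis_of i = basis_of j -> i = j.
Proof. exact: enum_val_inj. Qed.

Lemma basis_ofC i : #|basis_of i| = r.+1.
Proof. exact/cardB/basis_ofP. Qed.

(** Fix [a] in [X] but not [Y], and list the factor containing [a] first. It lies between the
    intersection and the union, so at distance two it is [X], [C + ac] or [C + ad]. If all three
    occur, their partners complete a $U_{2,4}$. *)
Lemma close_thin : close B -> no_U24 B -> thin_fibres.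
Proof.
move=> clB noB u v w u2 wuv wuw.
have v2 : mdeg v = 2 by rewrite -(weight_mdeg wuv).
have w2 : mdeg w = 2 by rewrite -(weight_mdeg wuw).
have [i [j uE]] := mdeg2P u2; set X := basis_of i; set Y := basis_of j.
have cXY : #|X| = #|Y| by rewrite !basis_ofC.
have sub_card i' (Z : {set 'I_n}) : Z \subset basis_of i' -> #|Z| = r.+1 -> Z = basis_of i'.
  by move=> sZ cZ; apply/eqP; rewrite eqEcard sZ cZ basis_ofC leqnn.
have [XY0|[a]] := set_0Vmem (X :\: Y).
  have XY : X = Y.
    by apply: sub_card (basis_ofC i); rewrite -setD_eq0 XY0.
  suff -> : u = v by rewrite eqxx.
  have [i' [j' vE]] := mdeg2P v2.
  have /weight_pair cov : weight (s2m [:: i; j]) = weight (s2m [:: i'; j']) by rewrite -uE -vE.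
  have sub l : l \in [:: i'; j'] -> l = i.
    move=> lij; apply: basis_of_inj; apply: sub_card (basis_ofC l).
    apply/subsetP=> x xl; have := cov x; rewrite /cover_count /= -/X -/Y -XY.
    case: (x \in X) => //; rewrite !inE in lij.
    by case/orP: lij xl => /eqP-> ->; case: (x \in _).
  have ji : j = i by apply: basis_of_inj; rewrite -/X XY.
  have i'i : i' = i by apply: sub; rewrite !inE eqxx.
  have j'i : j' = i by apply: sub; rewrite !inE eqxx orbT.
  by rewrite uE vE ji i'i j'i.
rewrite inE => /andP[aY aX].
have other t : mdeg t = 2 -> weight u = weight t -> exists i' j',
    [/\ t = s2m [:: i'; j'], a \in basis_of i', X :&: Y \subset basis_of i',
        basis_of i' \subset X :|: Y &
        X :&: Y \subset basis_of j' /\ forall x, x \in X :\: Y \/ x \in Y :\: X ->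
          x \notin basis_of i' -> x \in basis_of j'].
  move=> t2 wut; have [i1 [j1 tE]] := mdeg2P t2.
  have [i' [j' [tE' ai' cov]]] : exists i' j', [/\ t = s2m [:: i'; j'], a \in basis_of i' &
      cover_count [:: X; Y] =1 cover_count [:: basis_of i'; basis_of j']].
    have /weight_pair cov : weight (s2m [:: i; j]) = weight (s2m [:: i1; j1]) by rewrite -uE -tE.
    have := cov a; rewrite /cover_count /= aX (negPf aY).
    have [ai1 _|ai1 aj1] := boolP (a \in basis_of i1); first by exists i1, j1.
    exists j1, i1; rewrite tE s2m_swap; split=> // [|x]; first by case: (a \in basis_of j1) aj1.
    by apply: etrans (cov x) _; rewrite /cover_count /= addnCA.
  exists i', j'; split=> //.
  - apply/subsetP=> x; have := cov x; rewrite inE /cover_count /=.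
    by case: (x \in X); case: (x \in Y); case: (x \in basis_of i'); case: (x \in basis_of j').
  - apply/subsetP=> x; have := cov x; rewrite inE /cover_count /=.
    by case: (x \in X); case: (x \in Y); case: (x \in basis_of i'); case: (x \in basis_of j').
  split.
    apply/subsetP=> x; have := cov x; rewrite inE /cover_count /=.
    by case: (x \in X); case: (x \in Y); case: (x \in basis_of i'); case: (x \in basis_of j').
  move=> x; have := cov x; rewrite !inE /cover_count /=.
  by case: (x \in X); case: (x \in Y); case: (x \in basis_of i');
    case: (x \in basis_of j') => //= _ [].
(* The first factor and the weight determine the second factor. *)
have same t i1 j1 i2 j2 : i1 = i2 -> t = s2m [:: i1; j1] ->
    weight u = weight (s2m [:: i1; j1]) -> weight u = weight (s2m [:: i2; j2]) ->
    t = s2m [:: i2; j2].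
  move=> <- -> -> /weight_pair cov; congr (s2m [:: _; _]); apply: basis_of_inj.
  apply/setP=> x; have := cov x; rewrite /cover_count /=.
  by case: (x \in basis_of i1); case: (x \in basis_of j1); case: (x \in basis_of j2).
have [i1 [j1 [vE av Cv vXY [C1 Yv]]]] := other v v2 wuv.
have [i2 [j2 [wE aw Cw wXY [C2 Yw]]]] := other w w2 wuw.
have [E|i1i] := eqVneq i1 i.
  have -> : v = u by rewrite uE; apply: (same _ i1 j1); rewrite -?vE -?uE.
  by rewrite eqxx.
have [E|i2i] := eqVneq i2 i.
  have -> : w = u by rewrite uE; apply: (same _ i2 j2); rewrite -?wE -?uE.
  by rewrite eqxx orbT.
have [E|i12] := eqVneq i1 i2.
  have -> : v = w by rewrite wE; apply: (same _ i1 j1); rewrite -?vE -?wE.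
  by rewrite eqxx !orbT.
have clXY := clB _ _ (basis_ofP i) (basis_ofP j).
have neX l : a \in basis_of l -> X :&: Y \subset basis_of l -> l != i -> #|X :\: Y| = 2.
  move=> al Cl; apply: contraNeq => X2; apply/eqP/basis_of_inj/esym.
  apply: sub_card (basis_ofC i); rewrite -/X -(setID X Y) subUset Cl /=.
  have X1 : #|X :\: Y| = 1%N.
    have : (0 < #|X :\: Y|)%N by apply/card_gt0P; exists a; rewrite inE aY.
    by move: X2 clXY; rewrite -/X -/Y; case: #|_| => [|[|[|]]].
  have /cards1P[x xE] : #|X :\: Y| == 1%N by rewrite X1.
  have : a \in X :\: Y by rewrite inE aY.
  by rewrite xE inE => /eqP <-; rewrite sub1set.
have X2 := neX i1 av Cv i1i.
have Y2 : #|Y :\: X| = 2 by rewrite -(card_setD_sym cXY).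
have [C [a0 [b0 [c [d [XE0 YE U0 [a0C b0C cC dC]]]]]]] := dist2P X2 Y2.
have [b XE [U bC aC]] : exists2 b, X = a |: (b |: C) &
    [/\ uniq [:: a; b; c; d], b \notin C & a \notin C].
  move: aX aY; rewrite XE0 YE !inE !negb_or => + /and3P[ac ad aC].
  rewrite (negPf aC) orbF => /orP[]/eqP E; rewrite E; first by exists b0.
  by exists a0; rewrite 1?setU1CA //; split=> //; uniq_perm4 U0.
have U' := U; move: U'; rewrite /= !inE !negb_or !andbT.
move=> /and3P[/and3P[ab ac ad] /andP[bc bd] cd].
have CE : X :&: Y = C.
  apply/setP=> x; rewrite XE YE !inE; have [->|_] := eqVneq x a.
    by rewrite (negPf ac) (negPf ad) (negPf aC).
  have [->|_] := eqVneq x b; first by rewrite (negPf bc) (negPf bd) (negPf bC).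
  by case: (x \in C); rewrite ?orbT.
have form l : a \in basis_of l -> X :&: Y \subset basis_of l ->
    basis_of l \subset X :|: Y -> l != i ->
    basis_of l = a |: (c |: C) \/ basis_of l = a |: (d |: C).
  move=> al Cl lXY li; have cl := basis_ofC l; rewrite CE in Cl.
  have cX := basis_ofC i; rewrite -/X XE !cardsU1 bC !inE negb_or ab aC in cX.
  have [y yl yaC] : exists2 y, y \in basis_of l & y \notin a |: C.
    apply/subsetPn; apply/negP => /subset_leq_card; by rewrite cl -cX cardsU1 aC !add1n ltnn.
  have lE : basis_of l = a |: (y |: C).
    apply/esym; apply: sub_card; first by rewrite !subUset !sub1set al yl Cl.
    move: yaC; rewrite in_setU1 negb_or => /andP[ya yC].
    by rewrite -cX !cardsU1 yC !inE negb_or (eq_sym a y) ya aC.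
  have := subsetP lXY y yl; move: yaC; rewrite XE YE !inE negb_or => /andP[ya yC].
  rewrite (negPf ya) (negPf yC) !orbF /= => /or3P[] /eqP yE.
  - by case/eqP: li; apply: basis_of_inj; rewrite lE yE -XE.
  - by left; rewrite lE yE.
  - by right; rewrite lE yE.
have compl l l' x y : basis_of l = a |: (x |: C) -> uniq [:: a; b; x; y] ->
    y \in Y :\: X -> y \notin C -> X :&: Y \subset basis_of l' ->
    (forall z, z \in X :\: Y \/ z \in Y :\: X ->
       z \notin basis_of l -> z \in basis_of l') ->
    b |: (y |: C) \in B.
  move=> lE; rewrite /= !inE !negb_or !andbT.
  move=> /and3P[/and3P[_ ax ay] /andP[bx by_] xy] yYX yC Cl' l'E.
  suff -> : b |: (y |: C) = basis_of l' by apply: basis_ofP.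
  apply: sub_card.
    have bl' : b \in basis_of l'.
      apply: l'E; last by rewrite lE; neqs.
      by left; rewrite XE YE !inE eqxx !negb_or bc bd bC orbT.
    have yl' : y \in basis_of l' by apply: l'E; [right; rewrite inE|rewrite lE; neqs].
    by rewrite !subUset !sub1set -CE Cl' bl' yl'.
  by rewrite -(basis_ofC i) -/X XE !cardsU1 bC yC !inE !negb_or by_ bC aC ab.
have cYX : c \in Y :\: X.
  by rewrite YE XE !inE eqxx !negb_or (eq_sym c a) (eq_sym c b) ac bc cC.
have dYX : d \in Y :\: X.
  by rewrite YE XE !inE eqxx !negb_or (eq_sym d a) (eq_sym d b) ad bd dC orbT.
have U1 : uniq [:: a; b; d; c] by uniq_perm4 U.
have XB := basis_ofP i; have YB := basis_ofP j; rewrite -/X XE in XB; rewrite -/Y YE in YB.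
have v1B := basis_ofP i1; have w1B := basis_ofP i2.
case: (form i1 av Cv vXY i1i) (form i2 aw Cw wXY i2i) => E1 [] E2.
- by case/eqP: i12; apply: basis_of_inj; rewrite E1 E2.
- have bdB := compl _ _ _ _ E1 U dYX dC C1 Yv.
  have bcB := compl _ _ _ _ E2 U1 cYX cC C2 Yw.
  by rewrite E1 in v1B; rewrite E2 in w1B; case: (noB C a b c d).
- have bcB := compl _ _ _ _ E1 U1 cYX cC C1 Yv.
  have bdB := compl _ _ _ _ E2 U dYX dC C2 Yw.
  by rewrite E1 in v1B; rewrite E2 in w1B; case: (noB C a b c d).
by case/eqP: i12; apply: basis_of_inj; rewrite E1 E2.
Qed.

Lemma thin_pairs i1 j1 i2 j2 i3 j3 : thin_fibres ->
  cover_count [:: basis_of i1; basis_of j1] =1 cover_count [:: basis_of i2; basis_of j2] ->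
  cover_count [:: basis_of i1; basis_of j1] =1 cover_count [:: basis_of i3; basis_of j3] ->
  [\/ i1 = i2 \/ i1 = j2, i1 = i3 \/ i1 = j3 | i2 = i3 \/ i2 = j3].
Proof.
move=> thin /weight_pair w12 /weight_pair w13.
have eq2 a b c d : s2m [:: a; b] == s2m [:: c; d] :> 'X_{1..m} -> a = c \/ a = d.
  move=> /eqP/mnmP/(_ a); rewrite !mnmE /= eqxx.
  by have [|_] := eqVneq c a; [left|have [|_] := eqVneq d a; [right|]].
have := thin _ _ _ (mdeg_s2m [:: i1; j1]) w12 w13.
by case/or3P => /eq2; [constructor 1|constructor 2|constructor 3].
Qed.

(** The three perfect matchings of the four elements give three monomials of one fibre. *)
Lemma thin_no_U24 : thin_fibres -> no_U24 B.
Proof.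
move=> thin C a b c d; rewrite /= !inE !negb_or !andbT.
move=> /and3P[/and3P[ab ac ad] /andP[bc bd] cd] aC bC cC dC.
move=> abB cdB acB bdB adB bcB.
have [iab Eab] := basis_index abB; have [icd Ecd] := basis_index cdB.
have [iac Eac] := basis_index acB; have [ibd Ebd] := basis_index bdB.
have [iad Ead] := basis_index adB; have [ibc Ebc] := basis_index bcB.
have [||H|H|H] := @thin_pairs iab icd iac ibd iad ibc thin.
- rewrite Eab Ecd Eac Ebd; apply: pair_cover; apply/setP=> z; rewrite !inE.
    have [->|_] := eqVneq z a; first by rewrite (negPf ab) (negPf ac) (negPf ad) (negPf aC).
    have [->|_] := eqVneq z b; first by rewrite (negPf bc) (negPf bd) (negPf bC).
    have [->|_] := eqVneq z c; first by rewrite (negPf cd) (negPf cC).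
    by case: (z == d); case: (z \in C).
  by case: (z == a); case: (z == b); case: (z == c); case: (z == d); case: (z \in C).
- rewrite Eab Ecd Ead Ebc; apply: pair_cover; apply/setP=> z; rewrite !inE.
    have [->|_] := eqVneq z a; first by rewrite (negPf ab) (negPf ac) (negPf ad) (negPf aC).
    have [->|_] := eqVneq z b; first by rewrite (negPf bc) (negPf bd) (negPf bC).
    have [->|_] := eqVneq z c; first by rewrite (negPf cd) (negPf cC).
    by case: (z == d); case: (z \in C).
  by case: (z == a); case: (z == b); case: (z == c); case: (z == d); case: (z \in C).
all: move: H => [] /(congr1 basis_of); rewrite ?Eab ?Ecd ?Eac ?Ebd ?Ead ?Ebc.
- by move/setP/(_ b); rewrite !inE eqxx (eq_sym b a) (negPf ab) (negPf bc) (negPf bC).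
- by move/setP/(_ a); rewrite !inE eqxx (negPf ab) (negPf ad) (negPf aC).
- by move/setP/(_ b); rewrite !inE eqxx (eq_sym b a) (negPf ab) (negPf bd) (negPf bC).
- by move/setP/(_ a); rewrite !inE eqxx (negPf ab) (negPf ac) (negPf aC).
- by move/setP/(_ c); rewrite !inE eqxx (eq_sym c a) (negPf ac) (negPf cd) (negPf cC).
by move/setP/(_ a); rewrite !inE eqxx (negPf ab) (negPf ac) (negPf aC).
Qed.

(** Symmetric exchange of [e1] and of [e2] gives two more monomials in the fibre of [X], [Y]. At
    distance two they could coincide with factors interchanged; the third element [e3] tells them
    apart. *)
Lemma thin_close : thin_fibres ->
  (forall X Y x, X \in B -> Y \in B -> x \in X -> x \notin Y ->
    exists y, [/\ y \in Y, y \notin X, y |: (X :\ x) \in B & x |: (Y :\ y) \in B]) ->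
  close B.
Proof.
move=> thin symB X Y XB YB; rewrite leqNgt; apply/negP => /card_gt2P.
move=> [e1 [e2 [e3 [[]]]]]; rewrite !inE => /andP[e1Y e1X] /andP[e2Y e2X] /andP[e3Y e3X].
move=> [e12 e23 e31].
have [f1 [f1Y f1X X1B Y1B]] := symB _ _ _ XB YB e1X e1Y.
have [f2 [f2Y f2X X2B Y2B]] := symB _ _ _ XB YB e2X e2Y.
have [i iE] := basis_index XB; have [j jE] := basis_index YB.
have [i1 i1E] := basis_index X1B; have [j1 j1E] := basis_index Y1B.
have [i2 i2E] := basis_index X2B; have [j2 j2E] := basis_index Y2B.
have cov e f : e \in X -> e \notin Y -> f \in Y -> f \notin X ->
    cover_count [:: X; Y] =1 cover_count [:: f |: (X :\ e); e |: (Y :\ f)].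
  move=> eX eY fY fX x; rewrite /cover_count /= !inE.
  have [->|_] := eqVneq x e.
    by rewrite eX (negPf eY) (_ : (e == f) = false) //; apply: contraNF fX => /eqP <-.
  by have [->|_] := eqVneq x f; first by rewrite fY (negPf fX).
have [||H|H|H] := @thin_pairs i j i1 j1 i2 j2 thin.
- by rewrite iE jE i1E j1E; apply: cov.
- by rewrite iE jE i2E j2E; apply: cov.
all: move: H => [] /(congr1 basis_of); rewrite ?iE ?jE ?i1E ?j1E ?i2E ?j2E.
- move/setP/(_ e1); rewrite !inE eqxx e1X orbF => /esym/eqP E.
  by rewrite -E e1X in f1X.
- by move/setP/(_ e2); rewrite !inE e2X (negPf e2Y) andbF orbF (eq_sym e2) (negPf e12).
- move/setP/(_ e2); rewrite !inE eqxx e2X orbF => /esym/eqP E.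
  by rewrite -E e2X in f2X.
- by move/setP/(_ e1); rewrite !inE e1X (negPf e1Y) andbF orbF (negPf e12).
- move/setP/(_ e2); rewrite !inE eqxx e2X (eq_sym e2 e1) e12 orbT orbF => /esym/eqP E.
  by rewrite -E e2X in f2X.
by move/setP/(_ e3); rewrite !inE e3X (negPf e3Y) e31 andbF !orbF orbT (eq_sym e3) (negPf e23).
Qed.

End Graded.
End Toric.

(** * The diameter of the basis graph *)

Section Diameter.
Variables (n : nat) (B : {set {set 'I_n}}).
Implicit Types X Y Z : {set 'I_n}.

Lemma setD_triangle X Y Z : #|X :\: Y| <= #|X :\: Z| + #|Z :\: Y|.
Proof.
apply: leq_trans (_ : #|(X :\: Z) :|: (Z :\: Y)| <= _); last by rewrite cardsU leq_subr.
by apply/subset_leq_card/subsetP=> x; rewrite !inE; case: (x \in X); case: (x \in Y); case: (x \in Z).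
Qed.

Lemma path_card X p : path (basis_adj B) X p -> #|X :\: last X p| <= size p.
Proof.
elim: p X => [|Z p IHp] X /=; first by rewrite setDv cards0.
move=> /andP[/and3P[_ _ /eqP XZ] /IHp le].
by apply: leq_trans (setD_triangle _ _ Z) _; rewrite XZ add1n ltnS.
Qed.

(** An edge changes the difference by at most one element, which bounds distances below; exchange
    supplies the middle vertex of a path of length two. *)
Lemma diam_closeP : exchange B -> basis_graph_diam_le B 2 <-> close B.
Proof.
move=> exB; split=> [diam X Y XB YB|clB X Y XB YB].
  have [p [pth <- szp]] := diam X Y XB YB.
  exact: leq_trans (path_card pth) szp.
have eq0 X' Y' : X' \in B -> Y' \in B -> #|X' :\: Y'| = 0 -> X' = Y'.
  move=> XB' YB' /eqP; rewrite cards_eq0 setD_eq0 => sXY; apply/eqP.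
  by rewrite eqEcard sXY (exchange_card exB XB' YB') leqnn.
have adj1 X' Y' : X' \in B -> Y' \in B -> #|X' :\: Y'| = 1%N -> basis_adj B X' Y'.
  by move=> XB' YB' d1; rewrite /basis_adj XB' YB' d1.
have := clB _ _ XB YB; case dXY: #|X :\: Y| => [|[|[|]]] // _.
- by exists [::]; rewrite /= (eq0 _ _ XB YB dXY).
- by exists [:: Y]; rewrite /= adj1.
have /card_gt0P[x] : 0 < #|X :\: Y| by rewrite dXY.
rewrite inE => /andP[xY xX].
have [|y] := exB _ _ XB YB x; first by rewrite inE xY.
rewrite inE => /andP[yX yY] ZB; set Z := _ |: _ in ZB.
have dZY : #|Z :\: Y| = 1%N by move: dXY; rewrite (card_exchange xX xY yY) => -[].
exists [:: Z; Y]; split => //=; rewrite adj1 ?adj1 //.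
have : 0 < #|X :\: Z| <= 1; last by case: #|_| => [|[|]].
apply/andP; split.
  apply/card_gt0P; exists x; rewrite !inE xX eqxx andbT negb_or /= andbT.
  by apply: contraNneq yX => <-.
apply: leq_trans (_ : #|[set x]| <= _); last by rewrite cards1.
apply/subset_leq_card/subsetP=> z; rewrite !inE negb_or negb_and negbK.
by case/andP=> /andP[_ /orP[//|/negP zX] /zX].
Qed.

End Diameter.

Theorem theorem4p2 (k : fieldType) (n : nat) (B : {set {set 'I_n}}) :
  is_matroid_bases B -> (2 <= matroid_rank B)%N ->
  (nu_eq_1 (toric_ideal k B) <-> binary_matroid B /\ basis_graph_diam_le B 2).
Proof.
move=> [B0 exB] rank2.
have cardB : {in B, forall X : {set 'I_n}, #|X| = (matroid_rank B).-1.+1}.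
  rewrite prednK; last exact: ltnW.
  move=> X XB; rewrite /matroid_rank; case: pickP => [Y YB|/(_ X)]; last by rewrite XB.
  exact: exchange_card exB _ _ XB YB.
split=> [nu1|[binB diamB]].
  have thin := nu_thin cardB nu1.
  (* Binarity first: the representation supplies the symmetric exchange that [thin_close] takes as
     hypothesis. *)
  have binB := no_U24_binary exB (thin_no_U24 thin) B0.
  split=> //; apply/(diam_closeP exB).
  exact: thin_close thin (represents_sym_exchange binB).
have clB : close B by apply/(diam_closeP exB).
apply: (thin_nu cardB _ (quadric_generators k cardB exB clB)).
exact: close_thin cardB clB (binary_no_U24 binB).
Qed.
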